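(* Let $A$ be a finite alphabet, let $u_0$ and $v_0$ be finite non-empty words over $A$, and let $\boldsymbol\Upsilon=(\Upsilon_i)_{i\ge0}$ be a periodic sequence with values in $\{0,1\}$, of period $k\ge1$, containing an even number of $1$'s in one period (i.e. among $\Upsilon_0,\dots,\Upsilon_{k-1}$). Let $\mathbf u=\mathcal G(u_0,v_0,\boldsymbol\Upsilon)$. Then the continued fraction $\mathrm{CF}(\mathbf u)\in\mathbb F_2((A))$ is algebraic over $\mathbb F_2(A)$ of degree at most $2^k$.
   Context: The family $\mathcal G$: given finite words $u_0,v_0$ and a periodic $(0,1)$-sequence $\boldsymbol\Upsilon=(\Upsilon_i)_{i\ge0}$ (period $k$ means $\Upsilon_{i+k}=\Upsilon_i$ for all $i\ge 0$), define words for $i\ge0$ by concatenation: if $\Upsilon_i=0$, $u_{i+1}=u_iu_i$ and $v_{i+1}=v_iv_i$; if $\Upsilon_i=1$, $u_{i+1}=u_iv_i$ and $v_{i+1}=v_iu_i$. Each $u_i$ is a prefix of $u_{i+1}$; $\mathcal G(u_0,v_0,\boldsymbol\Upsilon)$ denotes the infinite sequence $\lim_i u_i$. The letters of $A=\{a_0,\dots,a_h\}$ are treated as independent formal variables over the field $\mathbb F_2$. Put $\mathbb F_2[A]=\mathbb F_2[a_0,\dots,a_h]$, $\mathbb F_2(A)=\mathbb F_2(a_0,\dots,a_h)$, and let $\mathbb F_2((A))$ be the ring of power series of the form $\varphi=\sum_{n_0,\dots,n_h\ge N}c_{n_0,\dots,n_h}a_0^{-n_0}\cdots a_h^{-n_h}$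 with $N\in\mathbb Z$ (depending on $\varphi$) and $c_{n_0,\dots,n_h}\in\mathbb F_2$. It contains $\mathbb F_2[A]$ and is an integral domain. The valuation is $\mathrm{val}(\varphi)=\min\{n_0+\cdots+n_h : c_{n_0,\dots,n_h}\ne 0\}$ (with $\min\emptyset=\infty$), and the norm of $\varphi$ is $2^{-\mathrm{val}(\varphi)}$; convergence is with respect to this norm. For a sequence $\mathbf u=(x_i)_{i\ge0}$ in $A$, set $[x_0]=x_0$ and $[x_0,\dots,x_m]=x_0+1/[x_1,\dots,x_m]\in\mathbb F_2((A))$ for $m\ge1$; $\mathrm{CF}(\mathbf u)=[x_0,x_1,\dots]$ is the limit of $([x_0,\dots,x_m])_m$ in $\mathbb F_2((A))$ (this limit always exists). ''Algebraic over $\mathbb F_2(A)$ of degree at most $D$'' means being a root of a nonzero one-variable polynomial of degree at most $D$ with coefficients in $\mathbb F_2(A)$ (equivalently, after clearing denominators, in $\mathbb F_2[A]$). *)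

(* Defs.v *)
From HB Require Import structures.
From mathcomp Require Import all_boot all_order all_algebra.
From mathcomp Require Import mpoly.
From mathcomp Require Import zify ring.
From mathcomp Require Import boolp classical_sets cardinality fsbigop.

Set Implicit Arguments.
Unset Strict Implicit.
Unset Printing Implicit Defensive.

Import Order.TTheory GRing.Theory Num.Theory.
Local Open Scope classical_set_scope.
Local Open Scope ring_scope.

Definition expo (n : nat) := {ffun 'I_n -> int}.
HB.instance Definition _ n := GRing.Zmodule.on (expo n).

Section Expo.
Variable n : nat.
Implicit Types m p q : expo n.

Lemma expoP p q : (forall i, p i = q i) <-> p = q.
Proof. by split=> [pq|->//]; apply/ffunP. Qed.
Lemma expoD p q i : (p + q) i = p i + q i. Proof. by rewrite ffunE. Qed.
Lemma expoN p i : (- p) i = - p i. Proof. by rewrite ffunE. Qed.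
Lemma expoB p q i : (p - q) i = p i - q i. Proof. by rewrite !ffunE. Qed.

Definition deg m : int := \sum_i m i.

Lemma degD p q : deg (p + q) = deg p + deg q.
Proof. by rewrite /deg -big_split; apply: eq_bigr => i _; rewrite ffunE. Qed.

Lemma degB p q : deg (p - q) = deg p - deg q.
Proof. by rewrite /deg -sumrB; apply: eq_bigr => i _; rewrite !ffunE. Qed.

Definition box (a b : expo n) := [set p : expo n | forall i, a i <= p i <= b i].

Lemma finite_box a b : finite_set (box a b).
Proof.
pose K := (\sum_i `|(b i - a i)%R|)%N.
pose h (w : {ffun 'I_n -> 'I_K.+1}) : expo n := [ffun i => a i + (w i : nat)%:Z].
apply: (sub_finite_set (B := h @` [set: {ffun 'I_n -> 'I_K.+1}])).
  move=> p pab; exists [ffun i => inord `|(p i - a i)%R|%N] => //.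
  apply/ffunP => i; rewrite !ffunE.
  have /andP[ap pb] := pab i.
  rewrite inordK; first by rewrite gez0_abs ?subr_ge0// addrC subrK.
  rewrite ltnS /K (bigD1 i)//= (leq_trans _ (leq_addr _ _))//; lia.
apply: finite_image; exact: finite_finset.
Qed.

End Expo.

Definition bounded_below (R : nmodType) n (c : expo n -> R) :=
  exists N : int, forall m, c m != 0 -> forall i, N <= m i.

(* The series with coefficient c m at a_0^(- m 0) ... a_(n-1)^(- m (n-1)): the
   exponents are those of the inverses of the letters, bounded below.
   F_2((a_0, ..., a_h)) is laurent 'F_2 h.+1. *)
Record laurent (R : nmodType) n := Laurent {
  lcoef :> expo n -> R;
  lcoef_bounded : bounded_below lcoef
}.

HB.instance Definition _ R n := gen_eqMixin (laurent R n).
HB.instance Definition _ R n := gen_choiceMixin (laurent R n).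

Lemma laurentP (R : nmodType) n (f g : laurent R n) : f =1 g -> f = g.
Proof.
case: f g => [f fb] [g gb] /= /funext fg.
by case: _ / fg gb => gb; congr Laurent; exact: Prop_irrelevance.
Qed.

Section LaurentRing.
Variables (R : idomainType) (n : nat).
Implicit Types f g h : laurent R n.
Implicit Types m p q : expo n.

Lemma bounded2 f g : exists N : int,
  (forall m, f m != 0 -> forall i, N <= m i) /\
  (forall m, g m != 0 -> forall i, N <= m i).
Proof.
have [[N Nf] [M Mg]] := (lcoef_bounded f, lcoef_bounded g).
exists (Num.min N M); split=> m nz i; rewrite ge_min.
  by rewrite Nf.
by rewrite Mg// orbT.
Qed.

Fact lzero_subproof : bounded_below (fun _ : expo n => 0 : R).
Proof. by exists 0 => m; rewrite eqxx. Qed.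
Definition lzero := Laurent lzero_subproof.

Fact ladd_subproof f g : bounded_below (fun m => f m + g m).
Proof.
have [N [Nf Ng]] := bounded2 f g; exists N => m nz i.
have [f0|] := eqVneq (f m) 0; last by move/Nf.
by apply: Ng; apply: contra_neq nz => g0; rewrite f0 g0 addr0.
Qed.
Definition ladd f g := Laurent (ladd_subproof f g).

Fact lopp_subproof f : bounded_below (fun m => - f m).
Proof.
by have [N Nf] := lcoef_bounded f; exists N => m; rewrite oppr_eq0; exact: Nf.
Qed.
Definition lopp f := Laurent (lopp_subproof f).

Fact laddA : associative ladd.
Proof. by move=> f g h; apply: laurentP => m /=; rewrite addrA. Qed.
Fact laddC : commutative ladd.
Proof. by move=> f g; apply: laurentP => m /=; rewrite addrC. Qed.
Fact ladd0 : left_id lzero ladd.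
Proof. by move=> f; apply: laurentP => m /=; rewrite add0r. Qed.
Fact laddN : left_inverse lzero lopp ladd.
Proof. by move=> f; apply: laurentP => m /=; rewrite addNr. Qed.

HB.instance Definition _ :=
  GRing.isZmodule.Build (laurent R n) laddA laddC ladd0 laddN.

Lemma lcoef0 m : (0 : laurent R n) m = 0. Proof. by []. Qed.
Lemma lcoefD f g m : (f + g) m = f m + g m. Proof. by []. Qed.
Lemma lcoefN f m : (- f) m = - f m. Proof. by []. Qed.
Lemma lcoefB f g m : (f - g) m = f m - g m. Proof. by []. Qed.

(* All but finitely many terms of the sum vanish, see lmul_box and finite_box. *)
Definition lmul_coef f g m : R := \sum_(p \in [set: expo n]) f p * g (m - p).

Fact lmul_subproof f g : bounded_below (lmul_coef f g).
Proof.
have [N [Nf Ng]] := bounded2 f g; exists (N + N) => m.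
move=> /(@fsbigN1 _ _ _ _ _ _ (fun m p => f p * g (m - p)) m) [p _].
rewrite mulf_eq0 negb_or => /andP[/Nf fp /Ng gp] i.
by move: (fp i) (gp i); rewrite expoB; lia.
Qed.
Definition lmul f g := Laurent (lmul_subproof f g).

Let cst (N : int) : expo n := [ffun => N].
Let cstE N i : cst N i = N. Proof. by rewrite ffunE. Qed.

Lemma lmul_box f g N m (D : set (expo n)) :
    (forall m, f m != 0 -> forall i, N <= m i) ->
    (forall m, g m != 0 -> forall i, N <= m i) ->
    box (cst N) (m - cst N) `<=` D ->
  lmul f g m = \sum_(p \in D) f p * g (m - p).
Proof.
move=> Nf Ng sD; apply/esym/fsbig_widen => // p [_ Dp] /=.
apply: contra_notP Dp => /eqP; rewrite mulf_eq0 negb_or => /andP[/Nf fp /Ng gp].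
by apply: sD => i; move: (fp i) (gp i); rewrite !expoB cstE; lia.
Qed.

Fact lmulC : commutative lmul.
Proof.
move=> f g; apply: laurentP => m; rewrite /= /lmul_coef.
rewrite (reindex_fsbigT (fun p => m - p)); last first.
  by exists (fun p => m - p) => p; rewrite subKr.
by apply: eq_fsbigr => p _; rewrite subKr mulrC.
Qed.

Fact lmulA : associative lmul.
Proof.
move=> f g h; apply: laurentP => m.
have [N1 [Nf1 Ng1]] := bounded2 f g; have [N2 Nh2] := lcoef_bounded h.
pose N := Num.min N1 N2.
have Nf p : f p != 0 -> forall i, N <= p i.
  by move=> nz i; rewrite ge_min Nf1.
have Ng p : g p != 0 -> forall i, N <= p i.
  by move=> nz i; rewrite ge_min Ng1.
have Nh p : h p != 0 -> forall i, N <= p i.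
  by move=> nz i; rewrite ge_min Nh2// orbT.
pose F p s := f p * g (s - p) * h (m - s).
pose P := box (cst N) (m - cst N - cst N).
pose S := box (cst N + cst N) (m - cst N).
have FP p s : F p s != 0 -> P p /\ S s.
  rewrite /F !mulf_eq0 !negb_or => /andP[/andP[/Nf fp /Ng gp] /Nh hp].
  by split=> i; move: (fp i) (gp i) (hp i); rewrite !(expoB, expoD, cstE); lia.
transitivity (\sum_(p \in [set: expo n]) \sum_(s \in [set: expo n]) F p s).
  apply: eq_fsbigr => p _; rewrite mulr_fsumr.
  rewrite [RHS](reindex_fsbigT (fun q => q + p)); last first.
    by exists (fun q => q - p) => q; rewrite ?addrK ?subrK.
  by apply: eq_fsbigr => q _; rewrite /F addrK opprD addrA addrAC mulrA.
transitivity (\sum_(s \in [set: expo n]) \sum_(p \in [set: expo n]) F p s);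
  last first.
  by apply: eq_fsbigr => s _; rewrite mulr_fsuml.
have TS p : \sum_(s \in [set: expo n]) F p s = \sum_(s \in S) F p s.
  apply/esym/fsbig_widen => // s [_ nS] /=.
  by apply: contra_notP nS => /eqP/FP[].
have TP s : \sum_(p \in [set: expo n]) F p s = \sum_(p \in P) F p s.
  apply/esym/fsbig_widen => // p [_ nP] /=.
  by apply: contra_notP nP => /eqP/FP[].
under eq_fsbigr do rewrite TS.
under [RHS]eq_fsbigr do rewrite TP.
transitivity (\sum_(p \in P) \sum_(s \in S) F p s).
  apply/esym/fsbig_widen => // p [_ nP] /=.
  apply: fsbig1 => s Ss; apply: contra_notP nP => /eqP.
  by case/FP.
rewrite exchange_fsbig; [|exact: finite_box..].
apply: fsbig_widen => // s [_ nS] /=.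
apply: fsbig1 => p Pp; apply: contra_notP nS => /eqP.
by case/FP.
Qed.

Fact lmulDl : left_distributive lmul ladd.
Proof.
move=> f g h; apply: laurentP => m.
have [N1 [Nf1 Ng1]] := bounded2 f g; have [N2 Nh2] := lcoef_bounded h.
pose N := Num.min N1 N2.
have Nf p : f p != 0 -> forall i, N <= p i.
  by move=> nz i; rewrite ge_min Nf1.
have Ng p : g p != 0 -> forall i, N <= p i.
  by move=> nz i; rewrite ge_min Ng1.
have Nh p : h p != 0 -> forall i, N <= p i.
  by move=> nz i; rewrite ge_min Nh2// orbT.
have Nfg p : ladd f g p != 0 -> forall i, N <= p i.
  have [f0|] := eqVneq (f p) 0; last by move/Nf.
  by rewrite /= f0 add0r; exact: Ng.
transitivity (lmul f h m + lmul g h m) => //.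
have boxE (u : laurent R n) : (forall p, u p != 0 -> forall i, N <= p i) ->
    lmul u h m = \sum_(p \in box (cst N) (m - cst N)) u p * h (m - p).
  by move=> Nu; apply: (lmul_box Nu Nh) => ?.
rewrite !boxE//.
rewrite -fsbig_split; last exact: finite_box.
by apply: eq_fsbigr => p _; rewrite /= mulrDl.
Qed.

Fact lmono_subproof p : bounded_below (fun m => (m == p)%:R : R).
Proof.
exists (- (\sum_i `|p i|)) => m; have [->|] := eqVneq m p; last by rewrite eqxx.
move=> _ i; rewrite (bigD1 i)//= lerNl.
have : 0 <= \sum_(j | j != i) `|p j| by apply: sumr_ge0.
by move: (\sum_(j | _) _) => x; lia.
Qed.
Definition lmono p := Laurent (lmono_subproof p).

Lemma lmul_mono p f m : lmul (lmono p) f m = f (m - p).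
Proof.
rewrite /= /lmul_coef -(@fsbig_widen _ _ _ _ [set p])//.
  by rewrite fsbig_set1 /= eqxx mul1r.
by move=> q [_ /eqP/negbTE qp] /=; rewrite qp mul0r.
Qed.

Fact lmul1 : left_id (lmono 0) lmul.
Proof. by move=> f; apply: laurentP => m; rewrite lmul_mono subr0. Qed.

Fact lone_neq0 : lmono 0 != 0.
Proof. by apply/eqP => /(congr1 (@lcoef _ _)) /(congr1 (@^~ 0)) /eqP /=; rewrite eqxx oner_eq0. Qed.

HB.instance Definition _ := GRing.Zmodule_isComNzRing.Build (laurent R n)
  lmulA lmulC lmul1 lmulDl lone_neq0.

Lemma lcoefM f g m : (f * g) m = \sum_(p \in [set: expo n]) f p * g (m - p).
Proof. by []. Qed.
Lemma lcoef1 m : (1 : laurent R n) m = (m == 0)%:R. Proof. by []. Qed.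
Lemma lcoef_monoM p f m : (lmono p * f) m = f (m - p).
Proof. exact: lmul_mono. Qed.

Lemma lmono0 : lmono 0 = 1. Proof. by []. Qed.
Lemma lmonoD p q : lmono (p + q) = lmono p * lmono q.
Proof.
by apply: laurentP => m; rewrite lcoef_monoM /= subr_eq addrC.
Qed.

Definition linvertible f := `[< exists g, g * f = 1 >].
(* laurent R n is not a field (a_0 + a_1 has no inverse); as usual in the
   library, the inverse of a non-unit is itself by convention. *)
Definition linv f : laurent R n :=
  if pselect (exists g, g * f = 1) is left ex then sval (cid ex) else f.

Fact lmulV : {in linvertible, left_inverse 1 linv *%R}.
Proof. by move=> f /asboolP ?; rewrite /linv; case: pselect => // ex; case: cid. Qed.
Fact linvertibleP f g : g * f = 1 -> linvertible f.
Proof. by move=> gf; apply/asboolP; exists g. Qed.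
Fact linv_out : {in [predC linvertible], linv =1 id}.
Proof. by move=> f /asboolP ?; rewrite /linv; case: pselect. Qed.

HB.instance Definition _ := GRing.ComNzRing_hasMulInverse.Build (laurent R n)
  lmulV linvertibleP linv_out.

Let shift (N : int) (a : 'X_{1..n}) : expo n := [ffun i => N + (a i)%:Z].
Let shiftE N a i : shift N a i = N + (a i)%:Z. Proof. by rewrite ffunE. Qed.

Lemma ex_lead f : f != 0 -> exists N a, f (shift N a) != 0 /\
  forall p, f p != 0 -> exists2 b : 'X_{1..n}, p = shift N b & (a <= b)%O.
Proof.
move=> f0; have [N Nf] := lcoef_bounded f.
have shiftP p : f p != 0 -> exists b, p = shift N b.
  move=> fp; exists [multinom `|(p i - N)%R|%N | i < n].
  apply/expoP => i; rewrite shiftE mnmE; have := Nf _ fp i; lia.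
suff [a [fa amin]] : exists a, f (shift N a) != 0 /\
    forall b, f (shift N b) != 0 -> (a <= b)%O.
  exists N, a; split=> // p fp.
  have [b pE] := shiftP _ fp.
  by exists b => //; apply: amin; rewrite -pE.
apply: contrapT => nomin; case/eqP: f0; apply: laurentP => p; rewrite lcoef0.
apply/eqP; apply: contrapT => /negP fp; have [b pE] := shiftP _ fp.
move: fp; rewrite pE => {p pE}; elim/(@ltmwf n): b => a IH fa.
by apply: nomin; exists a; split=> // b fb; rewrite leNgt; apply/negP => /IH/(_ fb).
Qed.

Fact lmul_integral f g : f * g = 0 -> (f == 0) || (g == 0).
Proof.
move=> fg; apply/norP => -[/ex_lead[N [a [fa amin]]] /ex_lead[M [b [gb bmin]]]].
move/(congr1 (@lcoef _ _))/(congr1 (@^~ (shift N a + shift M b))): fg.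
rewrite lcoefM -(@fsbig_widen _ _ _ _ [set shift N a])//; last first.
  move=> p [_ /= pa]; apply/eqP; apply: contra_notT pa.
  rewrite mulf_eq0 negb_or => /andP[/amin[a' -> aa'] /bmin[b' bE bb']].
  have abE : (a + b = a' + b')%MM.
    apply/mnmP => i; move/expoP/(_ i): bE; rewrite !(expoB, expoD, shiftE) !mnmDE; lia.
  congr shift; apply/eqP; rewrite eq_sym eq_le aa' /= leNgt; apply/negP => lt.
  by have := ltmc_le_add lt bb'; rewrite abE ltxx.
by rewrite fsbig_set1 addrAC subrr add0r => /eqP; rewrite mulf_eq0 (negbTE fa) (negbTE gb).
Qed.

HB.instance Definition _ :=
  GRing.ComUnitRing_isIntegral.Build (laurent R n) lmul_integral.

End LaurentRing.
Section FractionDecomposition.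
Import FracField.
Lemma fraction_div (R : idomainType) (x : {fraction R}) :
  x = tofrac \n_(repr x) / tofrac \d_(repr x).
Proof.
rewrite -[LHS]reprK; case: (repr x) => -[/= a b b0].
unlock tofrac; rewrite -[X in _ * X]pi_inv -[RHS]pi_mul.
apply/eqmodP; rewrite /= equivfE /mulf /invf /=.
by rewrite !numden_Ratio ?(oner_neq0, mul1r, mulr1)// mulrC.
Qed.
End FractionDecomposition.

Section Embedding.
Variables (R : idomainType) (n : nat).
Implicit Types p q m : expo n.

Fact lconst_subproof (c : R) : bounded_below (fun m : expo n => c *+ (m == 0)).
Proof.
have [N Nb] := lcoef_bounded (1 : laurent R n); exists N => m.
by have [->|] := eqVneq m 0; [move=> _; apply: Nb; rewrite lcoef1 eqxx oner_eq0|rewrite mulr0n eqxx].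
Qed.
Definition lconst (c : R) : laurent R n := Laurent (lconst_subproof c).

Lemma lcoef_constM c (f : laurent R n) m : (lconst c * f) m = c * f m.
Proof.
rewrite lcoefM -(@fsbig_widen _ _ _ _ [set 0])//.
  by rewrite fsbig_set1 /= eqxx mulr1n subr0.
by move=> q [_ /eqP/negbTE q0] /=; rewrite q0 mulr0n mul0r.
Qed.

Fact lconst_is_zmod_morphism : zmod_morphism lconst.
Proof. by move=> c d; apply: laurentP => m; rewrite /= mulrnBl. Qed.
Fact lconst_is_monoid_morphism : monoid_morphism lconst.
Proof.
split=> [|c d]; first exact: laurentP.
by apply: laurentP => m; rewrite lcoef_constM /= mulrnAr.
Qed.
HB.instance Definition _ :=
  GRing.isZmodMorphism.Build R (laurent R n) lconst lconst_is_zmod_morphism.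
HB.instance Definition _ :=
  GRing.isMonoidMorphism.Build R (laurent R n) lconst lconst_is_monoid_morphism.

Definition letter (i : 'I_n) : laurent R n :=
  lmono R [ffun j => - (i == j)%:R].

Definition lpoly (P : {mpoly R[n]}) : laurent R n := mmap lconst letter P.
HB.instance Definition _ := GRing.RMorphism.copy lpoly (mmap lconst letter).

Lemma lmonoMn (p : expo n) k : lmono R (p *+ k) = lmono R p ^+ k.
Proof.
by elim: k => [|k IH]; rewrite ?mulr0n ?lmono0 ?expr0// mulrS lmonoD IH exprS.
Qed.

Lemma lmono_sum (I : Type) (r : seq I) (F : I -> expo n) :
  lmono R (\sum_(i <- r) F i) = \prod_(i <- r) lmono R (F i).
Proof. by elim/big_rec2: _ => [|i x y _ <-]; rewrite ?lmono0// lmonoD. Qed.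

Lemma mmap1_letter (a : 'X_{1..n}) :
  mmap1 letter a = lmono R [ffun i => - (a i)%:Z].
Proof.
rewrite /mmap1; under eq_bigr do rewrite -lmonoMn.
rewrite -lmono_sum; congr lmono; apply/ffunP => j; rewrite sum_ffunE ffunE.
rewrite (bigD1 j)//= big1 => [|i ij].
  by rewrite addr0 ffunMnE ffunE eqxx mulNrn natz.
by rewrite ffunMnE ffunE (negbTE ij) oppr0 mul0rn.
Qed.

Lemma lcoef_lpoly (P : {mpoly R[n]}) (a : 'X_{1..n}) :
  lpoly P [ffun i => - (a i)%:Z] = P@_a.
Proof.
pose ev (f : laurent R n) : R := f [ffun i => - (a i)%:Z].
rewrite -/(ev _) /lpoly /mmap [ev _](big_morph ev (id1 := 0) (op1 := +%R))//.
rewrite [in RHS](mpolyE P) raddf_sum /=; apply: eq_bigr => b _.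
rewrite mcoeffZ mcoeffX /ev [LHS]lcoef_constM mmap1_letter /=; congr (_ * _%:R).
congr nat_of_bool; apply/eqP/eqP => [/ffunP ab|->//].
by apply/mnmP => i; move: (ab i); rewrite !ffunE => /oppr_inj[].
Qed.

Lemma lpoly_inj : injective lpoly.
Proof. by move=> P Q PQ; apply/mpolyP => a; rewrite -!lcoef_lpoly PQ. Qed.

Local Notation K := {fraction {mpoly R[n]}}.
Local Notation L := {fraction laurent R n}.
Local Notation "x %:F" := (@FracField.tofrac _ x).

(* F_2(A) is not contained in F_2((A)), only in its fraction field; lfrac does
   not depend on the representative of x by lfrac_div. *)
Definition lfrac (x : K) : L :=
  (lpoly \n_(repr x))%:F / (lpoly \d_(repr x))%:F.

Lemma lpoly_frac_neq0 (P : {mpoly R[n]}) : P != 0 -> (lpoly P)%:F != 0.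
Proof. by rewrite tofrac_eq0 -(rmorph0 lpoly) (inj_eq lpoly_inj). Qed.

Lemma lfrac_div (P Q : {mpoly R[n]}) :
  Q != 0 -> lfrac (P%:F / Q%:F) = (lpoly P)%:F / (lpoly Q)%:F.
Proof.
move=> Q0; rewrite /lfrac; set x := P%:F / Q%:F.
have d0 : (frac (repr x)).2 != 0 := denom_ratioP _.
apply/eqP; rewrite eqr_div ?lpoly_frac_neq0//.
rewrite -!rmorphM /=; apply/eqP; congr (_ (lpoly _)).
apply/eqP; rewrite -tofrac_eq !rmorphM /= -eqr_div ?tofrac_eq0//.
by rewrite -fraction_div.
Qed.

Lemma lfrac_tofrac (P : {mpoly R[n]}) : lfrac P%:F = (lpoly P)%:F.
Proof.
by rewrite -[P%:F]divr1 -tofrac1 lfrac_div ?oner_neq0// rmorph1 tofrac1 divr1.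
Qed.

Lemma lfrac_is_zmod_morphism : zmod_morphism lfrac.
Proof.
move=> x y; rewrite (fraction_div x) (fraction_div y).
move: (frac _).1 (frac _).2 (denom_ratioP (repr x)) => P1 P2 P0.
move: (frac _).1 (frac _).2 (denom_ratioP (repr y)) => Q1 Q2 Q0.
rewrite -mulNr addf_div ?tofrac_eq0//.
rewrite -!(rmorphN, rmorphM, rmorphD) /=.
rewrite !lfrac_div ?mulf_neq0// !(rmorphN, rmorphM, rmorphD) /=.
by rewrite -mulNr addf_div ?lpoly_frac_neq0.
Qed.
Lemma lfrac_is_monoid_morphism : monoid_morphism lfrac.
Proof.
split=> [|x y]; first by rewrite -tofrac1 lfrac_tofrac !rmorph1.
rewrite (fraction_div x) (fraction_div y).
move: (frac _).1 (frac _).2 (denom_ratioP (repr x)) => P1 P2 P0.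
move: (frac _).1 (frac _).2 (denom_ratioP (repr y)) => Q1 Q2 Q0.
rewrite mulf_div -!rmorphM /= !lfrac_div ?mulf_neq0// !rmorphM /=.
by rewrite mulf_div.
Qed.
HB.instance Definition _ :=
  GRing.isZmodMorphism.Build K L lfrac lfrac_is_zmod_morphism.
HB.instance Definition _ :=
  GRing.isMonoidMorphism.Build K L lfrac lfrac_is_monoid_morphism.

Definition algebraic_of_degree_le (D : nat) (f : laurent R n) :=
  exists P : {poly K}, [/\ P != 0, (size P <= D.+1)%N & root (map_poly lfrac P) f%:F].

Lemma algebraic_of_degree_leP (D : nat) (f : laurent R n) :
  algebraic_of_degree_le D f <->
  exists Q : {poly {mpoly R[n]}},
    [/\ Q != 0, (size Q <= D.+1)%N & root (map_poly lpoly Q) f].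
Proof.
have comm (Q : {poly {mpoly R[n]}}) :
    map_poly lfrac (map_poly (@FracField.tofrac _) Q) =
    map_poly (@FracField.tofrac _) (map_poly lpoly Q).
  by rewrite -!map_poly_comp; apply: eq_map_poly => x /=; exact: lfrac_tofrac.
split=> [[P [P0 sP rP]]|[Q [Q0 sQ rQ]]]; last first.
  exists (map_poly (@FracField.tofrac _) Q); split.
  - by rewrite map_poly_eq0_id0 ?tofrac_eq0 ?lead_coef_eq0.
  - exact: leq_trans (size_poly _ _) sQ.
  - by rewrite comm /root horner_map tofrac_eq0.
pose d : {mpoly R[n]} := \prod_(i < size P) \d_(repr P`_i).
have d0 : d != 0 by apply/prodf_neq0 => i _; exact: denom_ratioP.
pose c i := if insub i is Some j then
  \n_(repr P`_i) * \prod_(k < size P | k != j) \d_(repr P`_k) else 0.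
pose Q := \poly_(i < size P) c i.
have QE : map_poly (@FracField.tofrac _) Q = d%:F *: P.
  apply/polyP => i; rewrite coef_map coefZ coef_poly /=.
  case: ltnP => [iP|Pi]; last by rewrite nth_default// mulr0 tofrac0.
  rewrite /c; case: insubP => [j _ <-|]; last by rewrite iP.
  have -> : d = \d_(repr P`_j) * \prod_(k < size P | k != j) \d_(repr P`_k).
    by rewrite /d (bigD1 j).
  rewrite [X in _ = _ * X]fraction_div !tofracM [RHS]mulrC mulrA divfK//.
  by rewrite tofrac_eq0; exact: denom_ratioP.
exists Q; split.
- apply: contra_neq P0 => Q0; move: QE; rewrite Q0 map_poly0 => /esym/eqP.
  by rewrite scaler_eq0 tofrac_eq0 (negbTE d0) => /eqP.
- exact: leq_trans (size_poly _ _) sP.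
- rewrite /root -(tofrac_eq0) -horner_map -comm QE map_polyZ hornerZ.
  by rewrite (eqP rP) mulr0.
Qed.

End Embedding.
Section Norm.
Variables (R : idomainType) (n : nat).
Implicit Types f g : laurent R n.
Implicit Types m : expo n.

Definition is_val f (d : int) :=
  (exists2 m, f m != 0 & deg m = d) /\ (forall m, f m != 0 -> d <= deg m).

(* The value of [lval] at 0 is irrelevant. *)
Definition lval f : int := xget 0 [set d | is_val f d].

Lemma lvalP f : f != 0 -> is_val f (lval f).
Proof.
move=> f0; apply: xgetPex; have [N Nf] := lcoef_bounded f.
have degN m : f m != 0 -> N *+ n <= deg m.
  move=> fm; rewrite -[n in N *+ n]card_ord -sumr_const.
  by apply: ler_sum => i _; exact: Nf.
pose p k := `[< exists2 m, f m != 0 & deg m = N *+ n + k%:Z >].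
have exp : exists k, p k.
  have [m fm] : exists m, f m != 0.
    apply: contrapT => no; case/eqP: f0; apply: laurentP => m.
    by apply/eqP; apply: contrapT => /negP fm; apply: no; exists m.
  exists `|(deg m - N *+ n)%R|%N; apply/asboolP; exists m => //.
  by have := degN _ fm; lia.
have [k /asboolP[m fm mk] kmin] := ex_minnP exp.
exists (N *+ n + k%:Z); split; first by exists m.
move=> m' fm'; have mN := degN _ fm'.
have : p `|(deg m' - N *+ n)%R|%N by apply/asboolP; exists m' => //; lia.
by move/kmin; lia.
Qed.

(* The norm only takes rational values, so convergence needs no real numbers. *)
Definition lnorm f : rat := if f == 0 then 0 else 2%:Q ^ (- lval f).

Definition lconverges (s : nat -> laurent R n) f :=
  forall e : rat, 0 < e -> exists M : nat, forall j, (M <= j)%N -> lnorm (s j - f) < e.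

Lemma lnorm_ltP f (k : int) :
  lnorm f < 2%:Q ^ (- k) <-> forall m, f m != 0 -> k < deg m.
Proof.
rewrite /lnorm; have [->|f0] := eqVneq f 0.
  by split=> [_ m|_]; rewrite ?lcoef0 ?eqxx// exprz_gt0.
have [[m fm md] dmin] := lvalP f0.
rewrite ltr_eXz2l// ltrN2; split=> [kd m' /dmin|/(_ _ fm)]; last by rewrite md.
exact: lt_le_trans.
Qed.

Lemma exp2_lt (e : rat) : 0 < e -> exists k : nat, 2%:Q ^ (- k%:Z) < e.
Proof.
move=> e0; exists (Num.truncn e^-1).+1.
rewrite -invr_expz -[X in _ < X]invrK ltf_pV2 ?posrE ?invr_gt0 ?exprz_gt0//.
apply: lt_trans (truncnS_gt _) _; by rewrite -exprnP -[X in _ < X]natrX ltr_nat ltn_expl.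
Qed.

Lemma lconvergesP s f : lconverges s f <->
  forall k : nat, exists M : nat, forall j, (M <= j)%N ->
    forall m, (s j - f) m != 0 -> k%:Z < deg m.
Proof.
split=> [sf k|sf e /exp2_lt[k ke]].
  have [|M Mj] := sf (2%:Q ^ (- k%:Z)); first exact: exprz_gt0.
  by exists M => j /Mj/lnorm_ltP.
have [M Mj] := sf k; exists M => j /Mj/lnorm_ltP jk; exact: lt_trans ke.
Qed.

Lemma lconverges_unique s f g : lconverges s f -> lconverges s g -> f = g.
Proof.
move=> /lconvergesP sf /lconvergesP sg; apply: laurentP => m.
have [[M Mj] [M' M'j]] := (sf `|deg m|%N, sg `|deg m|%N).
pose j := maxn M M'.
have s0 h : (forall p : expo n, (s j - h) p != 0 -> `|deg m|%N%:Z < deg p) -> s j m = h m.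
  move=> hj; apply/eqP; rewrite -subr_eq0 -lcoefB; apply: contraT => /hj; lia.
by rewrite -(s0 f (Mj j (leq_maxl _ _))) -(s0 g (M'j j (leq_maxr _ _))).
Qed.

End Norm.

Fixpoint cfrac (K : unitRingType) (x : nat -> K) (m : nat) : K :=
  if m is m'.+1 then x 0%N + 1 / cfrac (fun i => x i.+1) m' else x 0%N.

Section ContinuedFraction.
Variables (R : idomainType) (n : nat).

Definition convergent (u : nat -> 'I_n) : nat -> laurent R n :=
  cfrac (fun i => letter R (u i)).

(* The limit exists and is unique by CF_converges and CF_unique, and the
   inverses taken in the convergents are genuine by convergent_unit. *)
Definition CF (u : nat -> 'I_n) : laurent R n :=
  xget 0 [set f | lconverges (convergent u) f].

Let small (k : nat) (f : laurent R n) :=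
  forall m, f m != 0 -> (forall i, 0 <= m i) /\ k%:Z <= deg m.

Let small0 k : small k 0.
Proof. by move=> m; rewrite lcoef0 eqxx. Qed.

Let smallN k f : small k f -> small k (- f).
Proof. by move=> fk m; rewrite lcoefN oppr_eq0 => /fk. Qed.

Let smallD k f g : small k f -> small k g -> small k (f + g).
Proof.
move=> fk gk m; rewrite lcoefD => nz.
have [f0|/fk//] := eqVneq (f m) 0; apply: gk.
by apply: contra_neq nz => g0; rewrite f0 g0 addr0.
Qed.

Let smallM k l f g : small k f -> small l g -> small (k + l) (f * g).
Proof.
move=> fk gl m; rewrite lcoefM.
move=> /(@fsbigN1 _ _ _ _ _ _ (fun m p => f p * g (m - p)) m) [p _].
rewrite mulf_eq0 negb_or => /andP[/fk[p0 pk] /gl[mp0 mpl]]; split.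
  by move=> i; move: (p0 i) (mp0 i); rewrite expoB; lia.
by move: mpl; rewrite degB; lia.
Qed.

Let small_le k l f : (k <= l)%N -> small l f -> small k f.
Proof. by move=> kl fl m /fl[m0 ml]; split=> //; lia. Qed.

Let small_eq0 f : (forall k, small k f) -> f = 0.
Proof.
move=> fs; apply: laurentP => m; rewrite lcoef0; apply/eqP.
by apply: contraT => /(fs `|deg m|.+1%N)[_]; lia.
Qed.

Let small1 : small 0 1.
Proof.
move=> m; rewrite lcoef1; have [->|] := eqVneq m 0; last by rewrite eqxx.
by move=> _; split=> [i|]; rewrite ?ffunE// /deg big1// => i _; rewrite ffunE.
Qed.

Let smallX k f : small 1 f -> small k (f ^+ k).
Proof. by move=> f1; elim: k => [|k IH]; rewrite ?expr0// exprS; exact: (@smallM 1). Qed.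

Let small_complete (s : nat -> laurent R n) :
    (forall k, small 0 (s k)) -> (forall k, small k (s k.+1 - s k)) ->
  exists g, forall k, small k (s k - g).
Proof.
move=> s0 ds.
have sE k l m : (k <= l)%N -> deg m < k%:Z -> s l m = s k m.
  move=> /subnK <- mk; elim: (l - k)%N => [//|d <-]; rewrite addSn.
  apply/eqP; rewrite -subr_eq0 -lcoefB; apply: contraT => /ds[_]; lia.
pose c m := s `|deg m|%N.+1 m.
have cb : bounded_below c by exists 0 => m /s0[].
exists (Laurent cb) => k m; rewrite lcoefB /= /c => nz; split=> [i|].
  have [sk0|/s0[]//] := eqVneq (s k m) 0.
  by apply: (s0 `|deg m|%N.+1 m _).1; apply: contra_neq nz => ->; rewrite sk0 subrr.
rewrite leNgt; apply: contra_neqN nz => mk; apply/eqP; rewrite subr_eq0; apply/eqP.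
have md : deg m < (`|deg m|%N.+1)%:Z by lia.
by case: (leqP k `|deg m|.+1%N) => [/sE->//|/ltnW/sE->].
Qed.

Let small_inv f : small 1 f -> exists2 g, small 0 g & g * (1 + f) = 1.
Proof.
move=> f1; pose s k := \sum_(i < k) (- f) ^+ i.
have sk k : small 0 (s k).
  rewrite /s; elim/big_ind: _ => //; first exact: smallD.
  by move=> i _; apply: (small_le (leq0n i)); apply: smallX; exact: smallN.
have [//|k|g gs] := small_complete (s := s).
  by rewrite /s big_ord_recr /= addrAC subrr add0r; apply: smallX; exact: smallN.
have g0 : small 0 g.
  by rewrite -[g](subKr (s 0%N)); apply: smallD => //; apply: smallN; exact: gs.
exists g => //; apply/eqP; rewrite -subr_eq0; apply/eqP; apply: small_eq0 => k.
have -> : g * (1 + f) - 1 = - ((s k - g) * (1 + f)) - (- f) ^+ k.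
  have := subrX1 (- f) k; rewrite -/(s k) => /(canRL (subrK _)) ->; ring.
apply: smallD; apply: smallN; last by apply: smallX; exact: smallN.
rewrite -[X in small X]addn0; apply: smallM; first exact: gs.
apply: smallD => //; exact: (small_le (leq0n 1) f1).
Qed.

Let letterV (i : 'I_n) : lmono R [ffun j => (i == j)%:R] * letter R i = 1.
Proof.
rewrite -lmonoD -lmono0; congr lmono; apply/expoP => j.
by rewrite expoD !ffunE; lia.
Qed.

Let small_letterV (i : 'I_n) : small 1 (lmono R [ffun j => (i == j)%:R]).
Proof.
move=> m /=; have [->|] := eqVneq m _; last by rewrite eqxx.
move=> _; split=> [j|]; first by rewrite ffunE; lia.
rewrite /deg (bigD1 i)//= ffunE eqxx lerDl; apply: sumr_ge0 => j _.
by rewrite ffunE; lia.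
Qed.

Let small_step (i : 'I_n) f : small 1 f ->
  letter R i + f \is a GRing.unit /\ small 1 (letter R i + f)^-1.
Proof.
move=> f1; set t := lmono R [ffun j => (i == j)%:R].
have [|g g0 gf] := @small_inv (t * f).
  by apply: (@small_le 1 2) => //; apply: (@smallM 1 1); first exact: small_letterV.
have inv : g * t * (letter R i + f) = 1 by rewrite -mulrA mulrDr letterV.
have un : letter R i + f \is a GRing.unit by apply/unitrPr; exists (g * t); rewrite mulrC.
split=> //; rewrite -[X in small 1 X]mul1r -inv mulrK//.
by apply: (@smallM 0 1) => //; exact: small_letterV.
Qed.

Lemma convergentS u m :
  convergent u m.+1 = letter R (u 0%N) + (convergent (fun i => u i.+1) m)^-1.
Proof. by rewrite /convergent /= div1r. Qed.

Let convergentV u m :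
  convergent u m \is a GRing.unit /\ small 1 (convergent u m)^-1.
Proof.
elim: m u => [|m IH] u; last by rewrite convergentS; apply: small_step; case: (IH (fun i => u i.+1)).
by rewrite -[convergent u 0]addr0; exact: small_step.
Qed.

Lemma convergent_unit u m : convergent u m \is a GRing.unit.
Proof. by case: (convergentV u m). Qed.

Lemma CF_converges u : lconverges (convergent u) (CF u).
Proof.
apply: (@xgetPex _ 0 [set f | lconverges (convergent u) f]).
pose s m := (convergent (fun i => u i.+1) m)^-1.
have [k|k|g gs] := small_complete (s := s).
- by apply: (@small_le 0 1) => //; case: (convergentV (fun i => u i.+1) k).
- rewrite /s; move: (fun i => _) => w; elim: k w => [|k IH] w.
    by apply: (@small_le 0 1) => //; apply: smallD; [|apply: smallN];
      exact: (convergentV w _).2.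
  have [U1 S1] := convergentV w k.+2; have [U2 S2] := convergentV w k.+1.
  have -> : (convergent w k.+2)^-1 - (convergent w k.+1)^-1 =
    (convergent w k.+1 - convergent w k.+2) *
    ((convergent w k.+2)^-1 * (convergent w k.+1)^-1).
    rewrite mulrBl mulrCA divrr// mulr1 mulrA divrr// mul1r //.
  apply: (@small_le k.+1 (k + (1 + 1))); first by lia.
  apply: smallM; last exact: smallM.
  rewrite convergentS [in X in _ - X]convergentS opprD addrACA subrr add0r -opprB.
  exact: smallN (IH _).
exists (letter R (u 0%N) + g); apply/lconvergesP => k; exists k.+2 => -[//|j] kj m.
rewrite convergentS opprD addrACA subrr add0r => /gs[_]; lia.
Qed.

Lemma CF_unique u f : lconverges (convergent u) f -> f = CF u.
Proof. by move=> uf; exact: lconverges_unique uf (CF_converges u). Qed.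

End ContinuedFraction.

Section Words.
Variables (h : nat).
Local Notation A := 'I_h.+1.

(* The pair (u_i, v_i). *)
Fixpoint words (u0 v0 : seq A) (Y : nat -> bool) (i : nat) : seq A * seq A :=
  if i is i'.+1 then
    let: (u, v) := words u0 v0 Y i' in
    if Y i' then (u ++ v, v ++ u) else (u ++ u, v ++ v)
  else (u0, v0).

(* If u0 and v0 are non-empty then u_j has length > j, and is a prefix of u_i
   for i >= j, see [Gword_prefix]; the default letter ord0 is then irrelevant. *)
Definition Gword (u0 v0 : seq A) (Y : nat -> bool) (j : nat) : A :=
  nth ord0 (words u0 v0 Y j).1 j.

Lemma words_size u0 v0 Y i : u0 != [::] -> v0 != [::] ->
  (i < size (words u0 v0 Y i).1)%N /\ (i < size (words u0 v0 Y i).2)%N.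
Proof.
move=> u00 v00; elim: i => [|i] /=; first by rewrite !lt0n !size_eq0.
case: (words _ _ _ _) => u v [/= iu iv]; case: (Y i); rewrite !size_cat; lia.
Qed.

Lemma words_prefix u0 v0 Y i d : prefix (words u0 v0 Y i).1 (words u0 v0 Y (d + i)).1.
Proof.
elim: d => [|d IH]; first exact: prefix_refl.
apply: prefix_trans IH _; rewrite addSn /=.
by case: (words _ _ _ _) => u v; case: (Y _); exact: prefix_prefix.
Qed.

Lemma Gword_prefix u0 v0 Y i : u0 != [::] -> v0 != [::] ->
  (words u0 v0 Y i).1 = mkseq (Gword u0 v0 Y) (size (words u0 v0 Y i).1).
Proof.
move=> u00 v00; apply: (@eq_from_nth _ ord0); rewrite ?size_mkseq// => j ji.
rewrite nth_mkseq// /Gword.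
have [jj _] := words_size Y j u00 v00.
have nthP a b : (a <= b)%N -> (j < size (words u0 v0 Y a).1)%N ->
    nth ord0 (words u0 v0 Y b).1 j = nth ord0 (words u0 v0 Y a).1 j.
  move=> /subnK <- ja; have /prefixP[w ->] := words_prefix u0 v0 Y a (b - a).
  by rewrite nth_cat ja.
by case: (leqP i j) => [/nthP->//|/ltnW/nthP->].
Qed.

End Words.

(* Main.v *)
(** In characteristic 2 put [B_w] for the inverse of the matrix of a word [w] and
    let [B_n], [C_n] be the matrices of [u_n], [v_n].  Once a 1 has been read the
    traces of [B_n] and [C_n] agree, so start at index [k] (without any 1, replace
    [v_n] by [u_n]); write [t_n] for the common value and
    [D = B_0 + C_0].  Then [D^2] is scalar and the recursion takes place in the
    commutative algebra generated by [D]: with [p_n] the parity of the number of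
    1's before [n] and [s_n = t_0 + p_n D],
      [s_n (B_n + 1) = t_n (B_0 + 1 + t_0 sum_(j < n) 1/t_j + (sum_(j < n) p_j/t_j) D)].
    As [(1, 1/CF(u))] is almost annihilated by [B_n / t_n], it lies in the kernel of
    the limit of the right-hand factor.  Since [p] is [k]-periodic, both series are
    combinations over F_2(A) of the powers [g^(2^r)], [r < k], of the single series
    [g = sum_q t_0/t_(qk)], which satisfies [g = 1 + (t_0/t_k) g^(2^k)].  Hence
    [CF(u)] belongs to F_2(A)(g), an extension of degree at most [2^k]. *)
Require Import Defs.
From mathcomp Require Import all_boot all_order all_algebra.
From mathcomp Require Import mpoly zify ring ssrAC.
From mathcomp Require Import boolp classical_sets fsbigop.

Set Implicit Arguments.
Unset Strict Implicit.
Unset Printing Implicit Defensive.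

Import Order.TTheory GRing.Theory Num.Theory.
Local Open Scope ring_scope.

(** * Degree of quotients in a simple extension *)

Section AlgebraicDegree.
Variables (K L : fieldType) (iota : {rmorphism K -> L}).
Implicit Types (v w x g : L).

(** Only the ring K[g] is needed: division enters through [x * v = w] in
    [adjoined_ratio_algebraic]. *)
Definition adjoined g v := exists p : {poly K}, v = (map_poly iota p).[g].

Lemma adjoined_cst g c : adjoined g (iota c).
Proof. by exists c%:P; rewrite map_polyC hornerC. Qed.
Lemma adjoined_gen g : adjoined g g.
Proof. by exists 'X; rewrite map_polyX hornerX. Qed.
Lemma adjoinedD g v w : adjoined g v -> adjoined g w -> adjoined g (v + w).
Proof. by move=> [p ->] [q ->]; exists (p + q); rewrite rmorphD hornerD. Qed.
Lemma adjoinedM g v w : adjoined g v -> adjoined g w -> adjoined g (v * w).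
Proof. by move=> [p ->] [q ->]; exists (p * q); rewrite rmorphM hornerM. Qed.

(* The D + 1 polynomials p^i q^(D - i) are linearly dependent modulo f. *)
Lemma adjoined_ratio_algebraic (D : nat) (f : {poly K}) g v w x :
    f != 0 -> (size f <= D.+1)%N -> root (map_poly iota f) g ->
    adjoined g v -> adjoined g w -> v != 0 -> x * v = w ->
  exists P : {poly K}, [/\ P != 0, (size P <= D.+1)%N & root (map_poly iota P) x].
Proof.
move=> f0 sf fg [q ->] [p ->]; set v' := _.[g] => v0 xv.
pose r (i : nat) := (p ^+ i * q ^+ (D - i)) %% f.
pose M := \matrix_(i < D.+1, j < D) (r i)`_j.
have /rowV0Pn[c cM c0] : kermx M != 0.
  rewrite kermx_eq0 /row_free; apply: contraTneq (rank_leq_col M) => ->.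
  by rewrite ltnn.
exists (\poly_(i < D.+1) c 0 (inord i)); split; last 2 first.
- exact: size_poly.
- have dep : \sum_(i < D.+1) c 0 i *: r i = 0.
    apply/polyP => j; rewrite coef0 coef_sum.
    case: (ltnP j D) => jD; last first.
      apply: big1 => i _; rewrite coefZ nth_default ?mulr0//.
      apply: leq_trans jD; rewrite -ltnS; apply: leq_trans sf.
      by rewrite ltn_modpN0.
    have /matrixP/(_ 0 (Ordinal jD)) := sub_kermxP cM.
    rewrite !mxE => cj; rewrite -[RHS]cj; apply: eq_bigr => i _.
    by rewrite coefZ !mxE.
  (* Since [f] vanishes at [g], reduction modulo [f] keeps values at [g], and p(g) = x q(g). So
     [dep] evaluated at [g] is [v' ^+ D] times the equation wanted for [x]. *)
  have ev (i : 'I_D.+1) : (map_poly iota (r i)).[g] = v' ^+ D * x ^+ i.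
    have := congr1 (fun h => (map_poly iota h).[g]) (divp_eq (p ^+ i * q ^+ (D - i)) f).
    rewrite rmorphD !rmorphM !rmorphXn /= hornerD !hornerM (rootP fg) mulr0 add0r => <-.
    rewrite !horner_exp -xv -/v' exprMn -mulrA -exprD.
    by rewrite subnKC 1?mulrC// -ltnS.
  have := congr1 (fun h => (map_poly iota h).[g]) dep.
  rewrite rmorph0 horner0 rmorph_sum /= horner_sum => sum0.
  rewrite /root; apply/eqP; apply: (mulfI (expf_neq0 D v0)).
  rewrite mulr0 -[RHS]sum0 poly_def rmorph_sum /= horner_sum mulr_sumr.
  apply: eq_bigr => i _; rewrite inord_val !map_polyZ !hornerZ map_polyXn hornerXn.
  by rewrite ev mulrCA.
- apply: contraNneq c0 => P0; apply/eqP/rowP => i; rewrite mxE.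
  by have /polyP/(_ i) := P0; rewrite coef0 coef_poly ltn_ord inord_val.
Qed.

End AlgebraicDegree.

(** * Two-by-two matrices: trace and determinant *)

Section Matrices.
Variable R : comUnitRingType.
Implicit Types A B C : 'M[R]_2.

Lemma sum_ord2 (V : nmodType) (F : 'I_2 -> V) : \sum_i F i = F 0 + F 1.
Proof. by rewrite !big_ord_recl big_ord0 addr0; congr (F _ + F _); apply/val_inj. Qed.

Lemma mxtrace2 A : \tr A = A 0 0 + A 1 1.
Proof. exact: sum_ord2. Qed.

Lemma matrix2P A B :
  A 0 0 = B 0 0 -> A 0 1 = B 0 1 -> A 1 0 = B 1 0 -> A 1 1 = B 1 1 -> A = B.
Proof.
move=> e00 e01 e10 e11; apply/matrixP => i j.
have ord2 (l : 'I_2) : l = 0 \/ l = 1.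
  by case: l => [[|[|//]] ?]; [left|right]; apply/val_inj.
by have [[->|->] [->|->]] := (ord2 i, ord2 j).
Qed.

Lemma det2 A : \det A = A 0 0 * A 1 1 - A 0 1 * A 1 0.
Proof.
rewrite (expand_det_row _ 0) sum_ord2 /cofactor !det_mx11 !mxE /=.
rewrite expr0 expr1 mul1r mulN1r mulrN.
by congr (_ * A _ _ - _ * A _ _); apply/val_inj.
Qed.

Lemma Cayley_Hamilton2 A : A * A = \tr A *: A - (\det A)%:A.
Proof.
rewrite mxtrace2 det2; apply: matrix2P;
by rewrite !mxE sum_ord2 /=; ring.
Qed.

(** This is the polar form of the determinant; it yields tr(CB) in [mxtrace_step_sqr]. *)
Lemma det_add2 A B : \det (A + B) = \det A + \det B + \tr A * \tr B - \tr (A * B).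
Proof. by rewrite !mxtrace2 !det2 !mxE !sum_ord2; ring. Qed.

End Matrices.


(** * The recursion of matrix pairs in characteristic 2 *)

Section Recurrence.
Variables (R : comUnitRingType) (R2 : 2%N \in [pchar R]).
Implicit Types A B C : 'M[R]_2.

Lemma addmm_pchar2 A : A + A = 0.
Proof. by apply/matrixP => i j; rewrite !mxE addrr_pchar2. Qed.

Lemma oppm_pchar2 A : - A = A.
Proof. by apply/matrixP => i j; rewrite mxE oppr_pchar2. Qed.

Lemma sqr_mx2 A : A * A = \tr A *: A + (\det A)%:A.
Proof. by rewrite Cayley_Hamilton2 oppm_pchar2. Qed.

Lemma sqr_mx2_tr0 A : \tr A = 0 -> A * A = (\det A)%:A.
Proof. by move=> A0; rewrite sqr_mx2 A0 scale0r add0r. Qed.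

Lemma comm_scalar_add A (a b : R) (m n : nat) :
  (a%:A + A *+ m) * (b%:A + A *+ n) = (b%:A + A *+ n) * (a%:A + A *+ m).
Proof.
rewrite !mulrDl !mulrDr !mulr_algl !mulr_algr !mulrnAl !mulrnAr.
by rewrite !scalerA [a * b]mulrC -!mulrnA [(n * m)%N]mulnC addrACA.
Qed.

Lemma sqr_scalar_add A (a c : R) (p : bool) : A * A = c%:A ->
  (a%:A + A *+ p) * (a%:A + A *+ p) = (a ^+ 2 + c *+ p)%:A.
Proof.
move=> AA; case: p => /=; last by rewrite !addr0 mulr_algl scalerA expr2.
rewrite !mulr1n mulrDr !mulrDl AA !mulr_algl mulr_algr.
by rewrite -addrA [X in _ + X]addrA addmm_pchar2 add0r scalerA -scalerDl expr2.
Qed.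

Lemma mxtrace_sqr2 A : \tr (A * A) = \tr A ^+ 2.
Proof.
rewrite sqr_mx2 mxtraceD !mxtraceZ mxtrace1 -mulr_natr.
by rewrite (pcharf0 R2) !mulr0 addr0 expr2.
Qed.

(** Word matrices multiply in reverse order: the matrix of u_n v_n is C_n B_n. *)
Definition step (y : bool) A B := (if y then B else A) * A.

Section Step.
Variables (B C : 'M[R]_2) (y : bool).
Hypotheses (dB : \det B = 1) (dC : \det C = 1) (tBC : \tr C = \tr B).

Let t := \tr B.
Let w := t%:A + (B + C) *+ y.

Lemma mxtrace_step : \tr (step y C B) = \tr (step y B C).
Proof.
rewrite /step; case: y; first by rewrite mxtrace_mulC.
by rewrite !mxtrace_sqr2 tBC.
Qed.

Lemma sqr_add_mx2 : (B + C) * (B + C) = (\det (B + C))%:A.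
Proof. by apply: sqr_mx2_tr0; rewrite mxtraceD tBC addrr_pchar2. Qed.

Let CE : C = (B + C) + B.
Proof. by rewrite addrAC addmm_pchar2 add0r. Qed.

(** Write C = (B + C) + B and use B^2 = tB + 1, which is Cayley-Hamilton for determinant 1. *)
Lemma stepE : step y B C = w * B + 1.
Proof.
rewrite /step /w; case: y => /=; last first.
  by rewrite addr0 sqr_mx2 dB scale1r mulr_algl.
rewrite mulr1n [in LHS]CE !mulrDl mulr_algl.
have -> : B * B = t *: B + 1 by rewrite sqr_mx2 dB scale1r.
by rewrite addrCA -!addrA.
Qed.

(** For a 1, CB + BC = (B + C)^2 + B^2 + C^2, where B^2 + C^2 = t(B + C); for a 0 only the latter
    occurs. The factor [w] is the same as in [stepE], which lets both identities be iterated
    together. *)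
Lemma step_add : step y B C + step y C B = w * (B + C).
Proof.
have BB : B * B = t *: B + 1 by rewrite sqr_mx2 dB scale1r.
have CC : C * C = t *: C + 1 by rewrite sqr_mx2 dC scale1r tBC.
rewrite /step /w mulrDl mulr_algl scalerDr; case: y => /=; last first.
  by rewrite mul0r addr0 BB CC addrACA addmm_pchar2 addr0.
rewrite mulr1n mulrDr !mulrDl BB CC.
rewrite [RHS](AC (2*(3*(1*2))) ((1*3)*(2*7)*(4*8)*(5*6))) /=.
by rewrite !addmm_pchar2 !add0r.
Qed.

(** Squaring is additive on [w] and gives t^2 + y det(B + C), because B + C has scalar square. *)
Lemma mxtrace_step_sqr : (\tr (step y B C))%:A = w * w.
Proof.
rewrite /w /step; case: y => /=; last first.
  by rewrite addr0 mxtrace_sqr2 mulr_algl scalerA expr2.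
have -> : \tr (C * B) = t ^+ 2 + \det (B + C).
  rewrite det_add2 dB dC tBC mxtrace_mulC addrr_pchar2// add0r.
  by rewrite oppr_pchar2// addrA -expr2 addrr_pchar2// add0r.
by have := sqr_scalar_add t true sqr_add_mx2.
Qed.

End Step.

Section Iterate.
Variables (B C : nat -> 'M[R]_2) (Y : nat -> bool).
Hypotheses (BS : forall n, B n.+1 = step (Y n) (B n) (C n))
  (CS : forall n, C n.+1 = step (Y n) (C n) (B n))
  (dB : forall n, \det (B n) = 1) (dC : forall n, \det (C n) = 1)
  (tBC : \tr (C 0) = \tr (B 0)) (tu : forall n, \tr (B n) \is a GRing.unit).

Let t n := \tr (B n).
Let D := B 0 + C 0.
Definition parity n := odd (\sum_(i < n) Y i).
Let s n := (t 0)%:A + D *+ parity n.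
Let sigma n := t 0 ^+ 2 + \det D *+ parity n.
(* [rho n *: s n] is the product over j < n of t_j + Y_j (B_j + C_j), an element of
   R[D] whose square is the scalar t_(j+1). *)
Fixpoint rho n := if n is m.+1 then rho m ^+ 2 * sigma m else (t 0)^-1.

Lemma tBCn n : \tr (C n) = t n.
Proof. by elim: n => // n IH; rewrite /t BS CS mxtrace_step. Qed.

Let parityS n : parity n.+1 = parity n (+) Y n.
Proof. by rewrite /parity big_ord_recr oddD oddb. Qed.

Let comm_s m n : s m * s n = s n * s m.
Proof. exact: comm_scalar_add. Qed.

Let sqr_s n : s n * s n = (sigma n)%:A.
Proof. exact: (sqr_scalar_add _ _ (sqr_add_mx2 tBC)). Qed.

Let sS n : s n.+1 = s n + D *+ Y n.
Proof.
rewrite /s parityS -addrA; congr (_ + _).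
case: parity; case: (Y n); rewrite ?mulr1n ?mulr0n ?add0r ?addr0 //.
by rewrite addmm_pchar2.
Qed.

Definition inv_trace_sum (c : pred nat) n : R := \sum_(j < n) (t j)^-1 *+ c j.

Let F n := B 0 + 1 + (t 0 * inv_trace_sum xpredT n)%:A + inv_trace_sum parity n *: D.

Let FS n : F n.+1 = F n + (t n)^-1 *: s n.
Proof.
rewrite /F /inv_trace_sum !big_ord_recr /= mulr1n mulrDr !scalerDl.
rewrite /s (scalerDr (t n)^-1) scalerA [(t n)^-1 * _]mulrC -scalerMnl -scalerMnr.
by rewrite -!addrA; do 3!congr (_ + _); rewrite addrCA.
Qed.

(** Multiplication by [w] carries stage n to stage n + 1. As B_(n+1) + 1 = w B_n = w(B_n + 1) + w,
    the third identity gains the summand s_n / t_n of [FS]. *)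
Lemma iterate_invariant n :
  [/\ B n + C n = rho n *: (s n * D), t n = rho n * sigma n &
      B n + 1 = rho n *: (s n * F n)].
Proof.
elim: n => [|n [Dn tn Fn]].
  have s0 : s 0 = (t 0)%:A by rewrite /s /parity big_ord0 addr0.
  have X0 A : rho 0 *: (s 0 * A) = A.
    rewrite s0 mulr_algl scalerA mulVr; last exact: tu.
    by rewrite scale1r.
  rewrite !X0 /sigma /F /inv_trace_sum /parity !big_ord0.
  by rewrite mulr0 !scale0r !addr0 expr2 mulKr ?tu.
pose w := (t n)%:A + (B n + C n) *+ Y n.
have wE : w = rho n *: (s n * s n.+1).
  rewrite /w tn Dn sS (mulrDr (s n) (s n)) sqr_s (scalerDr (rho n)) scalerA.
  by rewrite mulrnAr scalerMnr.
(* The square of s_n is the scalar [sigma n], which is absorbed into [rho n.+1]. *)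
have wX A : w * (rho n *: (s n * A)) = rho n.+1 *: (s n.+1 * A).
  rewrite wE -scalerAl -scalerAr scalerA -expr2 [s n * _]comm_s -!mulrA.
  by rewrite [s n * (_ * _)]mulrA sqr_s mulr_algl -scalerAr scalerA.
have tS : t n.+1 = rho n.+1 * sigma n.+1.
  have := mxtrace_step_sqr (Y n) (dB n) (dC n) (tBCn n).
  rewrite -BS -/(t n) -/(t n.+1) -/w {2}wE wX sqr_s scalerA.
  by move=> /matrixP/(_ 0 0); rewrite !mxE !mulr1.
have wD : w * (B n + C n) = rho n.+1 *: (s n.+1 * D) by rewrite {1}Dn wX.
split=> //.
  by rewrite BS CS step_add// tBCn.
rewrite BS stepE// ?tBCn// -addrA addmm_pchar2 addr0 -/(t n) -/w.
rewrite FS mulrDr scalerDr -wX -Fn -scalerAr scalerA.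
have -> : rho n.+1 * (t n)^-1 = rho n.
  have -> : rho n.+1 = rho n * (rho n * sigma n) by rewrite mulrA -expr2.
  by rewrite -tn mulrK ?tu.
by rewrite comm_s -wE mulrDr mulr1 -addrA addmm_pchar2 addr0.
Qed.

(** Eliminates [rho] between t_n = rho_n sigma_n and rho_(n+1) = rho_n^2 sigma_n. *)
Lemma trace_recurrence n : sigma n * t n.+1 = sigma n.+1 * t n ^+ 2.
Proof.
have [_ -> _] := iterate_invariant n.+1; have [_ -> _] := iterate_invariant n.
by rewrite /=; ring.
Qed.

Let sigma_unit n : sigma n \is a GRing.unit.
Proof.
have [_ tn _] := iterate_invariant n.
by have := tu n; rewrite -/(t n) tn unitrM => /andP[].
Qed.

(** At even parity s_n is the scalar t_0, so the third identity of [iterate_invariant] can be solved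
    for F_n. *)
Lemma iterate_even n : ~~ parity n ->
  B 0 + 1 + (t 0 * inv_trace_sum xpredT n)%:A + inv_trace_sum parity n *: D =
  (t 0 / t n) *: (B n + 1).
Proof.
move=> /negbTE par; have [_ tn ->] := iterate_invariant n.
rewrite /sigma par addr0 in tn; rewrite -/(F n) /s par addr0 mulr_algl !scalerA.
have -> : t 0 / t n * rho n * t 0 = 1; last by rewrite scale1r.
have -> : t 0 / t n * rho n * t 0 = rho n * t 0 ^+ 2 * (t n)^-1 by ring.
by rewrite -tn divrr ?tu.
Qed.

Section Periodic.
Variable k : nat.
Hypotheses (Yk : forall i, Y (i + k)%N = Y i) (evenk : ~~ parity k).

Lemma parity_addk n : parity (n + k) = parity n.
Proof.
elim: n => [|n IH]; last by rewrite addSn !parityS IH Yk.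
by rewrite add0n (negbTE evenk) /parity big_ord0.
Qed.

Lemma parity_mulk q r : parity (q * k + r) = parity r.
Proof. by elim: q => // q IH; rewrite mulSn -addnA addnC parity_addk. Qed.

(** As [sigma] is periodic, [trace_recurrence] shows that t_(qk+r) / t_r is squared each time r
    grows by one. *)
Lemma trace_mulk q r : t (q * k + r) = t r * (t (q * k) / t 0) ^+ (2 ^ r).
Proof.
elim: r => [|r IH]; first by rewrite addn0 expr1 mulrCA divrr ?tu// mulr1.
apply: (mulrI (sigma_unit r)).
have sE i : sigma (q * k + i) = sigma i by rewrite /sigma parity_mulk.
have := trace_recurrence (q * k + r); rewrite -addnS !sE IH => ->.
by rewrite (mulrA (sigma r)) trace_recurrence expnSr exprM; ring.
Qed.

Definition geom q : R := \sum_(j < q) t 0 / t (j * k).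

Let ratioS q : t 0 / t (q.+1 * k) = t 0 / t k * (t 0 / t (q * k)) ^+ (2 ^ k).
Proof.
rewrite mulSn addnC trace_mulk invrM ?unitrX ?unitrM ?unitrV ?tu//.
by rewrite -exprVn invrM ?unitrV ?tu// invrK -!mulrA [X in _ * X]mulrC.
Qed.

Let pchar_exprD (x y : R) i : (x + y) ^+ (2 ^ i) = x ^+ (2 ^ i) + y ^+ (2 ^ i).
Proof. by rewrite exprDn_pchar // pnatX pnatE ?R2. Qed.

Let geom0 : geom 0 = 0. Proof. exact: big_ord0. Qed.
Let geom_recr q : geom q.+1 = geom q + t 0 / t (q * k).
Proof. exact: big_ord_recr. Qed.

(** The 2^k-th power is additive, and by [ratioS] it shifts the terms by one place after
    multiplication by t_0 / t_k; the first term is 1. *)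
Lemma geomS q : geom q.+1 = 1 + t 0 / t k * geom q ^+ (2 ^ k).
Proof.
elim: q => [|q IH].
  rewrite geom_recr geom0 mul0n divrr ?tu// add0r expr0n expn_eq0 /=.
  by rewrite mulr0 addr0.
by rewrite geom_recr {1}IH geom_recr pchar_exprD mulrDr ratioS addrA.
Qed.

(** By [trace_mulk], the terms of residue r modulo k are multiples of 2^r-th powers of the terms of
    [geom]; Frobenius sums them over q. *)
Lemma inv_trace_sum_geom (c : pred nat) q : (forall q r, c (q * k + r)%N = c r) ->
  inv_trace_sum c (q * k) = \sum_(r < k) (t r)^-1 *+ c r * geom q ^+ (2 ^ r).
Proof.
move=> cE; elim: q => [|q IH].
  rewrite mul0n /inv_trace_sum geom0 big_ord0 big1// => r _.
  by rewrite expr0n expn_eq0 /= mulr0.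
rewrite /inv_trace_sum mulSn addnC big_split_ord /= -/(inv_trace_sum c _) IH -big_split.
apply: eq_bigr => r _; rewrite geom_recr pchar_exprD mulrDr; congr (_ + _).
rewrite cE trace_mulk invrM ?unitrX ?unitrM ?unitrV ?tu//.
by rewrite -exprVn invrM ?unitrV ?tu// invrK mulrnAl mulrC.
Qed.

End Periodic.
End Iterate.
End Recurrence.


(** * Filtration by order, completeness, and tails of continued fractions *)

Section Filtration.
Variables (R : idomainType) (n : nat).
Implicit Types (f g c : laurent R n) (m p : expo n).

(** Nonnegative exponents provide the uniform lower bound that a limit needs to be a Laurent series;
    [order_ge] measures arbitrary elements. *)
Definition small (k : nat) f :=
  forall m, f m != 0 -> (forall i, 0 <= m i) /\ k%:Z <= deg m.

Definition order_ge (k : int) f := forall m, f m != 0 -> k <= deg m.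

Lemma smallN k f : small k f -> small k (- f).
Proof. by move=> fk m; rewrite lcoefN oppr_eq0 => /fk. Qed.

Lemma smallD k f g : small k f -> small k g -> small k (f + g).
Proof.
move=> fk gk m; rewrite lcoefD.
by have [->|/fk//] := eqVneq (f m) 0; rewrite add0r => /gk.
Qed.

Lemma smallB k f g : small k f -> small k g -> small k (f - g).
Proof. by move=> fk gk; apply: smallD => //; exact: smallN. Qed.

Lemma lcoefM_neq0 f g m : (f * g) m != 0 -> exists p, f p != 0 /\ g (m - p) != 0.
Proof.
rewrite lcoefM => /(@fsbigN1 _ _ _ _ _ _ (fun m p => f p * g (m - p)) m)[p _].
by rewrite mulf_eq0 negb_or => /andP[]; exists p.
Qed.

Lemma smallM k l f g : small k f -> small l g -> small (k + l) (f * g).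
Proof.
move=> fk gl m /lcoefM_neq0[p [/fk[p0 pk] /gl[mp0 mpl]]]; split=> [i|].
  by move: (p0 i) (mp0 i); rewrite expoB; lia.
by move: mpl; rewrite degB; lia.
Qed.

Lemma small_le k l f : (k <= l)%N -> small l f -> small k f.
Proof. by move=> kl fl m /fl[m0 ml]; split=> //; lia. Qed.

Lemma smallMl k f g : small 0 f -> small k g -> small k (f * g).
Proof. by move=> f0 gk; rewrite -[k]add0n; exact: smallM. Qed.

Lemma smallMr k f g : small k f -> small 0 g -> small k (f * g).
Proof. by move=> fk g0; rewrite -[k]addn0; exact: smallM. Qed.

Lemma small0 k : small k 0.
Proof. by move=> m; rewrite lcoef0 eqxx. Qed.

Lemma small1 : small 0 1.
Proof.
move=> m; rewrite lcoef1; have [->|] := eqVneq m 0; last by rewrite eqxx.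
by move=> _; split=> [i|]; rewrite ?ffunE// /deg big1// => i _; rewrite ffunE.
Qed.

Lemma smallX k f : small 0 f -> small 0 (f ^+ k).
Proof.
by move=> f0; elim: k => [|k IH]; rewrite ?expr0 ?exprS; [exact: small1|exact: smallMl].
Qed.

Lemma small_sum (I : finType) k (F : I -> laurent R n) :
  (forall i, small k (F i)) -> small k (\sum_i F i).
Proof. by move=> Fk; elim/big_ind: _ => //; [exact: small0|exact: smallD]. Qed.

Lemma smallBX k l f g : small 0 f -> small 0 g -> small k (f - g) ->
  small k (f ^+ l - g ^+ l).
Proof.
move=> f0 g0 fg; rewrite subrXX; apply: smallMr => //.
by apply: small_sum => i; apply: smallMl; exact: smallX.
Qed.

Lemma small_order_ge k f : small k f -> order_ge k f.
Proof. by move=> fk m /fk[]. Qed.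

Lemma order_geD k f g : order_ge k f -> order_ge k g -> order_ge k (f + g).
Proof.
move=> fk gk m; rewrite lcoefD.
by have [->|/fk//] := eqVneq (f m) 0; rewrite add0r => /gk.
Qed.

Lemma order_geM k l f g : order_ge k f -> order_ge l g -> order_ge (k + l) (f * g).
Proof.
move=> fk gl m /lcoefM_neq0[p [/fk pk /gl mpl]].
by move: mpl; rewrite degB; lia.
Qed.

Lemma order_ge_ex f : exists k : nat, order_ge (- k%:Z) f.
Proof.
have [N Nf] := lcoef_bounded f; exists `|N *+ n|%N => m /Nf Nm.
suff : N *+ n <= deg m by lia.
by rewrite -[n in N *+ n]card_ord -sumr_const; apply: ler_sum => i _; exact: Nm.
Qed.

Lemma order_ge_eq0 f (k : int) : (forall q : nat, order_ge (q%:Z + k) f) -> f = 0.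
Proof.
move=> fk; apply: laurentP => m; rewrite lcoef0; apply/eqP.
by apply: contraT => /(fk `|deg m - k|.+1%N); lia.
Qed.

Lemma small_eq0 f : (forall k, small k f) -> f = 0.
Proof.
by move=> fs; apply: (@order_ge_eq0 _ 0) => q; rewrite addr0; exact: small_order_ge.
Qed.

Lemma small_complete (s : nat -> laurent R n) :
    (forall k, small 0 (s k)) -> (forall k, small k (s k.+1 - s k)) ->
  exists g, forall k, small k (g - s k).
Proof.
move=> s0 ds.
have sE k l m : (k <= l)%N -> deg m < k%:Z -> s l m = s k m.
  move=> /subnK <- mk; elim: (l - k)%N => [//|d <-]; rewrite addSn.
  by apply/eqP; rewrite -subr_eq0 -lcoefB; apply: contraT => /ds[_]; lia.
(* This index exceeds [deg m], so by [sE] the coefficient at [m] has become stationary. *)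
pose c m := s `|deg m|%N.+1 m.
have cb : bounded_below c by exists 0 => m /s0[].
exists (Laurent cb) => k m; rewrite lcoefB /= /c => nz; split=> [i|].
  have [c0|/s0[]//] := eqVneq (s `|deg m|%N.+1 m) 0.
  by move: nz; rewrite c0 sub0r oppr_eq0 => /s0[].
rewrite leNgt; apply: contra_neqN nz => mk; apply/eqP; rewrite subr_eq0; apply/eqP.
by case: (leqP k `|deg m|.+1%N) => [/sE->//|/ltnW/sE->//]; lia.
Qed.

(** The map is a contraction: x - y divides x^d - y^d, and [c] raises the order by one. *)
Lemma ex_fixpoint c d : small 1 c ->
  exists g, forall q, small q (g - iter q (fun x => 1 + c * x ^+ d) 0).
Proof.
move=> c1; have step0 x : small 0 x -> small 0 (1 + c * x ^+ d).
  move=> x0; apply: smallD; first exact: small1.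
  by apply: (@small_le 0 1) => //; apply: smallMr => //; exact: smallX.
have iter0 q : small 0 (iter q (fun x => 1 + c * x ^+ d) 0).
  by elim: q => [|q IH]; [exact: small0|exact: step0].
apply: small_complete => // q; elim: q => [|q IH] /=.
  by rewrite subr0; apply: step0; exact: small0.
rewrite opprD addrACA subrr add0r -mulrBr -add1n; apply: smallM => //.
by apply: smallBX; [exact: iter0 q.+1|exact: iter0 q|].
Qed.

Lemma fixpointE c d g : small 1 c ->
    (forall q, small q (g - iter q (fun x => 1 + c * x ^+ d) 0)) ->
  small 0 g /\ g = 1 + c * g ^+ d.
Proof.
move=> c1 gs; have g0 : small 0 g by rewrite -[g]subr0; exact: (gs 0%N).
have iter0 q : small 0 (iter q (fun x => 1 + c * x ^+ d) 0).
  rewrite -[iter _ _ _](subKr g); apply: smallB => //.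
  exact: small_le (gs q).
split=> //; apply/eqP; rewrite -subr_eq0; apply/eqP/small_eq0 => q.
set i := iter q (fun x => 1 + c * x ^+ d) 0.
have -> : g - (1 + c * g ^+ d) = (g - (1 + c * i ^+ d)) - c * (g ^+ d - i ^+ d) by ring.
apply: smallB; first by apply: (@small_le q q.+1) => //; exact: (gs q.+1).
apply: smallMl; first exact: small_le c1.
by apply: smallBX; [exact: g0|exact: iter0|exact: gs].
Qed.

(** The inverse is the fixed point of x = 1 - f x, the case d = 1. *)
Lemma small_inv f : small 1 f -> exists2 g, small 0 g & g * (1 + f) = 1.
Proof.
move=> f1; have [g gs] := @ex_fixpoint (- f) 1 (smallN f1).
have [g0 gE] := fixpointE (smallN f1) gs.
by exists g => //; rewrite mulrDr mulr1 {1}gE expr1; ring.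
Qed.

Definition inv_letter (i : 'I_n) : laurent R n := lmono R [ffun j => (i == j)%:R].

Lemma inv_letterK i : inv_letter i * letter R i = 1.
Proof.
rewrite -lmonoD -lmono0; congr lmono; apply/expoP => j.
by rewrite expoD !ffunE; lia.
Qed.

Lemma small_inv_letter i : small 1 (inv_letter i).
Proof.
move=> m /=; have [->|] := eqVneq m _; last by rewrite eqxx.
move=> _; split=> [j|]; first by rewrite ffunE; lia.
rewrite /deg (bigD1 i)//= ffunE eqxx lerDl; apply: sumr_ge0 => j _.
by rewrite ffunE; lia.
Qed.

(** Factor out the letter: a + f = a(1 + f/a), where f/a has order at least 2. *)
Lemma letter_add_small i f : small 1 f ->
  letter R i + f \is a GRing.unit /\ small 1 (letter R i + f)^-1.
Proof.
move=> f1; have [|g g0 gf] := @small_inv (inv_letter i * f).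
  by apply: (@small_le 1 2) => //; apply: (@smallM 1 1) => //; exact: small_inv_letter.
have inv : g * inv_letter i * (letter R i + f) = 1 by rewrite -mulrA mulrDr inv_letterK.
have un : letter R i + f \is a GRing.unit.
  by apply/unitrPr; exists (g * inv_letter i); rewrite mulrC.
split=> //; rewrite -[X in small 1 X]mul1r -inv mulrK//.
by apply: smallMl => //; exact: small_inv_letter.
Qed.

Lemma small_convergentV (u : nat -> 'I_n) (m : nat) : small 1 (convergent R u m)^-1.
Proof.
elim: m u => [|m IH] u; last first.
  by rewrite convergentS; apply: (letter_add_small _ _).2; exact: IH.
by rewrite -[convergent R u 0]addr0; apply: (letter_add_small _ _).2; exact: small0.
Qed.

Lemma small_lconverges k (s : nat -> laurent R n) f g :
  (forall q, small k (s q.+1 - g)) -> lconverges s f -> small k (f - g).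
Proof.
move=> sk /lconvergesP sf m; have [M /(_ _ (leqnSn _)) Mm] := sf `|deg m|%N.
have [-> /sk//|sfm _] := eqVneq ((f - g) m) ((s M.+1 - g) m).
have /Mm : (s M.+1 - f) m != 0.
  by move: sfm; rewrite !lcoefB subr_eq0; apply: contra_neq => ->.
by lia.
Qed.

Lemma lconverges_order_ge (s : nat -> laurent R n) f (k : nat) :
  lconverges s f -> exists M, forall q, (M <= q)%N -> order_ge k%:Z (s q - f).
Proof. by move=> /lconvergesP/(_ k)[M sM]; exists M => q /sM + m nz => /(_ _ nz)/ltW. Qed.

Section Tail.
Variable u : nat -> 'I_n.
Let u' i := u i.+1.
Let f := CF R u - letter R (u 0).
Let y q := (convergent R u' q)^-1.

Let yE q : convergent R u q.+1 - letter R (u 0) = y q.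
Proof. by rewrite convergentS addrAC subrr add0r. Qed.

Let small_f : small 1 f.
Proof.
rewrite /f; apply: (small_lconverges _ (CF_converges R u)) => q.
rewrite yE; exact: small_convergentV.
Qed.

Let mulf_CF : f * CF R u' = 1.
Proof.
apply/eqP; rewrite -subr_eq0; apply/eqP/(@order_ge_eq0 _ 0) => k; rewrite addr0.
(* CF(u') may have negative order, so the convergent that multiplies it is taken accurate to order k
   + K. *)
have [K xK] := order_ge_ex (CF R u').
have [M1 uM] := lconverges_order_ge (k + K) (CF_converges R u).
have [M2 uM'] := lconverges_order_ge k (CF_converges R u').
pose q := maxn M1 M2; have yq : y q * convergent R u' q = 1.
  by rewrite mulVr ?convergent_unit.
have -> : f * CF R u' - 1 =
    - ((convergent R u q.+1 - CF R u) * CF R u' + y q * (convergent R u' q - CF R u')).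
  rewrite mulrBr yq -(yE q) /f.
  by move: (CF R u) (CF R u') (convergent R u q.+1) (letter R _) => a b c d; ring.
move=> m; rewrite lcoefN oppr_eq0; apply: order_geD.
  have -> : k%:Z = (k + K)%:Z + - K%:Z by lia.
  by apply: order_geM => //; apply: uM; rewrite leqW// leq_maxl.
rewrite -[k%:Z]add0r; apply: order_geM; last by apply: uM'; rewrite leq_maxr.
by apply/small_order_ge/(@small_le 0 1) => //; exact: small_convergentV.
Qed.

Lemma CF_tail : CF R u = letter R (u 0) + (CF R u')^-1.
Proof.
have x'u : CF R u' \is a GRing.unit by apply/unitrPr; exists f; rewrite mulrC.
by rewrite -[(CF R u')^-1]mul1r -mulf_CF mulrK// addrC subrK.
Qed.

Lemma CF_unit : CF R u \is a GRing.unit.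
Proof.
rewrite -[CF R u](subrK (letter R (u 0))) addrC.
by case: (letter_add_small (u 0) small_f).
Qed.

Lemma small_CFV : small 1 (CF R u)^-1.
Proof.
rewrite -[CF R u](subrK (letter R (u 0))) addrC.
by case: (letter_add_small (u 0) small_f).
Qed.

End Tail.

End Filtration.

(** * Matrices of words, their traces, and their action on the continued fraction *)

Section WordMatrix.
Variables (R : idomainType) (R2 : 2%N \in [pchar R]) (n : nat).
Local Notation L := (laurent R n).
Implicit Types (w : seq 'I_n).

Lemma laurent_pchar2 : 2%N \in [pchar L].
Proof.
by apply: (rmorph_pchar (@lconst R n)).
Qed.

(* In characteristic 2 this is the inverse of [[a, 1], [1, 0]]. *)
Definition letter_mx (i : 'I_n) : 'M[L]_2 :=
  \matrix_(r, c) if (r == 1) && (c == 1) then letter R i else (r != c)%:R.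

Definition word_mx w : 'M[L]_2 := foldr (fun i A => A * letter_mx i) 1 w.

Lemma word_mx_cat v w : word_mx (v ++ w) = word_mx w * word_mx v.
Proof. by elim: v => [|i v IH] /=; rewrite ?mulr1// IH mulrA. Qed.

Lemma det_word_mx w : \det (word_mx w) = 1.
Proof.
elim: w => [|i w IH] /=; first exact: det1.
rewrite det_mulmx IH mul1r det2 !mxE /= mul0r add0r mulr1.
by rewrite oppr_pchar2 ?laurent_pchar2.
Qed.

Lemma word_mx_cons0 i w r : word_mx (i :: w) r 0 = word_mx w r 1.
Proof. by rewrite /= mxE sum_ord2 !mxE /= mulr0 mulr1 add0r. Qed.

Lemma word_mx_cons1 i w r :
  word_mx (i :: w) r 1 = word_mx w r 0 + word_mx w r 1 * letter R i.
Proof. by rewrite /= mxE sum_ord2 !mxE /= mulr1. Qed.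

Definition inv_word w : L := \prod_(i <- w) inv_letter R i.

Lemma small_inv_word w : small (size w) (inv_word w).
Proof.
rewrite /inv_word; elim: w => [|i w IH]; first by rewrite big_nil; exact: small1.
by rewrite big_cons -[size _]add1n; apply: smallM => //; exact: small_inv_letter.
Qed.

Lemma inv_word_unit w : inv_word w \is a GRing.unit.
Proof.
by apply: rpred_prod => i _; apply/unitrPr; exists (letter R i); exact: inv_letterK.
Qed.

(** The product of the letters is the leading monomial of the entry (1, 1). *)
Let normalized w r c := inv_word w * word_mx w r c.

Let normalized_cons0 i w r : normalized (i :: w) r 0 = inv_letter R i * normalized w r 1.
Proof. by rewrite /normalized word_mx_cons0 /inv_word big_cons mulrA. Qed.

Let normalized_cons1 i w r :
  normalized (i :: w) r 1 = inv_letter R i * normalized w r 0 + normalized w r 1.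
Proof.
rewrite /normalized word_mx_cons1 /inv_word big_cons.
have := inv_letterK R i; move: (inv_letter R i) (letter R i) => b a ba.
rewrite mulrDr !mulrA; congr (_ + _).
by rewrite mulrC !mulrA [a * b]mulrC ba mul1r.
Qed.

Let small_normalized w :
  [/\ small 0 (normalized w 0 0), small 1 (normalized w 0 1),
      small 0 (normalized w 1 0) & small 1 (normalized w 1 1 - 1)].
Proof.
elim: w => [|i w [s00 s01 s10 s11]].
  rewrite /normalized /inv_word big_nil !mxE /= !mul1r subrr.
  by split; [exact: small1|exact: small0..].
have s11' : small 0 (normalized w 1 1).
  rewrite -[normalized w 1 1](subrK 1); apply: smallD; last exact: small1.
  exact: small_le s11.
rewrite !normalized_cons0 !normalized_cons1.
have iM k f : small k f -> small k.+1 (inv_letter R i * f).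
  by move=> fk; rewrite -add1n; apply: smallM => //; exact: small_inv_letter.
split.
- by apply: (@small_le _ _ 0 2) => //; exact: iM.
- by apply: smallD => //; exact: iM.
- by apply: (@small_le _ _ 0 1) => //; exact: iM.
- by rewrite -addrA; apply: smallD => //; exact: iM.
Qed.

(** The trace inherits the leading monomial of the entry (1, 1). The empty word is excluded, its
    trace being 2 = 0. *)
Lemma word_mx_trace w : w != [::] ->
  exists2 f, small 1 f & inv_word w * \tr (word_mx w) = 1 + f.
Proof.
case: w => // i w _; exists (normalized (i :: w) 0 0 + (normalized (i :: w) 1 1 - 1)).
  have [_ s01 _ s11] := small_normalized w.
  have [_ _ _ s11'] := small_normalized (i :: w).
  apply: smallD => //; rewrite normalized_cons0; apply: (@small_le _ _ 1 2) => //.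
  by apply: (@smallM _ _ 1 1) => //; exact: small_inv_letter.
rewrite mxtrace2 /normalized mulrDr addrCA [1 + _]addrC subrK //.
Qed.

Lemma trace_word_mx_unit w : w != [::] -> \tr (word_mx w) \is a GRing.unit.
Proof.
move=> /word_mx_trace[f /small_inv[g _ gf] wE]; apply/unitrPr.
by exists (g * inv_word w); rewrite mulrC -mulrA wE.
Qed.

Lemma small_trace_word_mxV w : w != [::] -> small (size w) (\tr (word_mx w))^-1.
Proof.
move=> w0; have [f /small_inv[g g0 gf] wE] := word_mx_trace w0.
have -> : (\tr (word_mx w))^-1 = g * inv_word w.
  apply: (mulIr (trace_word_mx_unit w0)).
  by rewrite mulVr ?trace_word_mx_unit// -mulrA wE.
by apply: smallMl => //; exact: small_inv_word.
Qed.

(** The leading monomials of the two traces differ by the product of the letters of [w]. *)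
Lemma small_trace_word_mx_ratio v w : v != [::] ->
  small (size w) (\tr (word_mx v) / \tr (word_mx (v ++ w))).
Proof.
move=> v0; have vw0 : v ++ w != [::] by case: v v0.
have [f f1 vE] := word_mx_trace v0.
have [g /small_inv[g' g'0 g'g] vwE] := word_mx_trace vw0.
have -> : \tr (word_mx v) / \tr (word_mx (v ++ w)) = (1 + f) * g' * inv_word w.
  apply: (mulIr (trace_word_mx_unit vw0)).
  rewrite divrK ?trace_word_mx_unit//; apply: (mulrI (inv_word_unit v)).
  rewrite vE.
  transitivity ((1 + f) * (g' * (inv_word (v ++ w) * \tr (word_mx (v ++ w))))).
    by rewrite vwE g'g mulr1.
  by rewrite {1}/inv_word big_cat; rewrite /inv_word /=; ring.
apply: smallMl; last exact: small_inv_word.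
apply: smallMl => //; apply: smallD; [exact: small1|exact: small_le f1].
Qed.

(* The inverse matrices of the letters remove partial quotients one by one, each step
   multiplying the vector by the inverse of a complete quotient. *)
Lemma small_word_mx_CF (u : nat -> 'I_n) m r :
  small 0 (word_mx (mkseq u m) r 0 + word_mx (mkseq u m) r 1 * (CF R u)^-1).
Proof.
elim: m u => [|m IH] u.
  rewrite !mxE; apply: smallD; first by case: eqP => _; [exact: small1|exact: small0].
  apply: smallMl; last first.
    exact: (small_le (leq0n 1) (@small_CFV _ _ u)).
  by case: (r == 1); [exact: small1|exact: small0].
pose u' i := u i.+1.
have -> : mkseq u m.+1 = u 0%N :: mkseq u' m.
  by rewrite /mkseq /= (iotaDl 1) -map_comp.
rewrite word_mx_cons0 word_mx_cons1; set A := word_mx _.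
(* This is [CF_tail] divided by CF(u), with signs removed by characteristic 2. *)
have ax : letter R (u 0%N) * (CF R u)^-1 = 1 + (CF R u')^-1 * (CF R u)^-1.
  apply: (mulIr (CF_unit R u)); rewrite mulrDl !mulrVK ?CF_unit// mul1r {1}CF_tail.
  by rewrite -addrA addrr_pchar2 ?laurent_pchar2// addr0.
have aux (a b l y y' : L) : l * y = 1 + y' * y ->
    b + (a + b * l) * y = y * (a + b * y') + (b + b).
  by move=> ly; rewrite mulrDl -mulrA ly; ring.
rewrite (aux _ _ _ _ _ ax).
rewrite addrr_pchar2 ?laurent_pchar2// addr0; apply: smallMl; last exact: IH.
exact: (small_le (leq0n 1) (@small_CFV _ _ u)).
Qed.

End WordMatrix.


(** * Series that are rational functions of the letters *)

Section Rational.
Variables (R : idomainType) (n : nat).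
Local Notation "x %:F" := (@FracField.tofrac _ x).
Implicit Types f g : laurent R n.

Definition rational f := exists c : {fraction {mpoly R[n]}}, f%:F = lfrac c.

Lemma rational_nat a : rational a%:R.
Proof. by exists a%:R; rewrite !rmorph_nat. Qed.
Lemma rationalD f g : rational f -> rational g -> rational (f + g).
Proof. by move=> [c fc] [d gd]; exists (c + d); rewrite !rmorphD /= fc gd. Qed.
Lemma rationalM f g : rational f -> rational g -> rational (f * g).
Proof. by move=> [c fc] [d gd]; exists (c * d); rewrite !rmorphM /= fc gd. Qed.
Lemma rationalV f : f \is a GRing.unit -> rational f -> rational f^-1.
Proof. by move=> fu [c fc]; exists c^-1; rewrite rmorphV //= fc fmorphV. Qed.
Lemma rational_letter i : rational (letter R i).
Proof.
exists ('X_i)%:F; rewrite lfrac_tofrac; congr _%:F.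
by rewrite /lpoly mmapX mmap1U.
Qed.

Lemma rational_word_mx w r c : rational (word_mx R w r c).
Proof.
elim: w r c => [|i w IH] r c; first by rewrite mxE; exact: rational_nat.
rewrite mxE sum_ord2; apply: rationalD; apply: rationalM => //; rewrite mxE;
by case: (_ && _); [exact: rational_letter|exact: rational_nat].
Qed.

End Rational.

(** * The limit matrix and the algebraic equation *)

Section Main.
Variables (h k : nat) (u : nat -> 'I_h.+1) (wu wv : nat -> seq 'I_h.+1) (Y : nat -> bool).
Hypotheses (k_gt0 : (0 < k)%N)
  (Yk : forall i, Y (i + k)%N = Y i) (evenk : ~~ parity Y k)
  (wuS : forall i, wu i.+1 = wu i ++ if Y i then wv i else wu i)
  (wvS : forall i, wv i.+1 = wv i ++ if Y i then wu i else wv i)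
  (wu0 : wu 0 != [::]) (wv0 : wv 0 != [::])
  (wuE : forall i, wu i = mkseq u (size (wu i))).
Local Notation L := (laurent 'F_2 h.+1).
Local Notation wmx := (@word_mx 'F_2 h.+1).
(** The families [wu] and [wv] stay abstract so that this can be met either by words shifted past a
    1 or by two copies of one family. *)
Hypothesis tr0 : \tr (wmx (wv 0)) = \tr (wmx (wu 0)).
Local Notation K := {fraction {mpoly 'F_2[h.+1]}}.
Local Notation "x %:F" := (@FracField.tofrac _ x).

Let F2 : 2%N \in [pchar 'F_2] := pchar_Fp (isT : prime 2).
Let L2 : 2%N \in [pchar L] := laurent_pchar2 F2 _.
Let B i := wmx (wu i).
Let C i := wmx (wv i).
Let D := B 0 + C 0.
Let t i := \tr (B i).

Let w_neq0 i : wu i != [::] /\ wv i != [::].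
Proof.
elim: i => // i [IH IH']; rewrite wuS wvS.
by case: (wu i) IH (wv i) IH' => [//|a s] _ [].
Qed.

Let BS i : B i.+1 = step (Y i) (B i) (C i).
Proof. by rewrite /B wuS word_mx_cat /step; case: (Y i). Qed.
Let CS i : C i.+1 = step (Y i) (C i) (B i).
Proof. by rewrite /C wvS word_mx_cat /step; case: (Y i). Qed.
Let dB i : \det (B i) = 1. Proof. exact: det_word_mx. Qed.
Let dC i : \det (C i) = 1. Proof. exact: det_word_mx. Qed.
Let tu i : t i \is a GRing.unit.
Proof. by apply: trace_word_mx_unit; case: (w_neq0 i). Qed.

Let wu_cat i : exists2 w, wu i = wu 0 ++ w & (i <= size w)%N.
Proof.
elim: i => [|i [w wE iw]]; first by exists [::]; rewrite ?cats0.
exists (w ++ if Y i then wv i else wu i); first by rewrite wuS wE catA.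
rewrite size_cat -addn1 leq_add//; have [n1 n2] := w_neq0 i.
by case: (Y i); rewrite lt0n size_eq0.
Qed.

Let small_tV i : small i (t i)^-1.
Proof.
have [w wE iw] := wu_cat i.
apply: (@small_le _ _ i (size (wu i))).
  by rewrite wE size_cat (leq_trans iw)// leq_addl.
by apply: small_trace_word_mxV => //; case: (w_neq0 i).
Qed.

Let kappa := t 0 / t k.

(** The word [wu k] extends [wu 0] by at least k letters, and k is positive. *)
Let small_kappa : small 1 kappa.
Proof.
have [w wE kw] := wu_cat k; apply: (@small_le _ _ 1 (size w)).
  exact: leq_trans kw.
by rewrite /kappa /t /B wE; exact: small_trace_word_mx_ratio.
Qed.

(** The partial sums are the iterates of a contraction, so [ex_fixpoint] supplies their limit g. *)
Let geomE q : geom B k q = iter q (fun x => 1 + kappa * x ^+ (2 ^ k)) 0.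
Proof.
elim: q => [|q IH]; first exact: big_ord0.
by rewrite (geomS L2 BS CS dB dC tr0 tu Yk evenk) IH.
Qed.

Section Limit.
Variable g : L.
Hypothesis gs : forall q, small q (g - iter q (fun x => 1 + kappa * x ^+ (2 ^ k)) 0).
Let g0 : small 0 g. Proof. by case: (fixpointE small_kappa gs). Qed.

(** For k-periodic [c] this is the limit of [inv_trace_sum c (q * k)], by [inv_trace_sum_geom];
    hence [E] is the limit of F_n along n = qk. *)
Let S (c : pred nat) : L := \sum_(r < k) (t r)^-1 *+ c r * g ^+ (2 ^ r).
Let E := B 0 + 1 + (t 0 * S xpredT)%:A + S (parity Y) *: D.
Let y := (CF 'F_2 u)^-1.

Let small_S (c : pred nat) q : (forall q r, c (q * k + r)%N = c r) ->
  small q (S c - inv_trace_sum B c (q * k)).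
Proof.
move=> cE; rewrite (inv_trace_sum_geom L2 BS CS dB dC tr0 tu Yk evenk)// -sumrB.
apply: small_sum => r; rewrite -mulrBr; apply: smallMl.
  by case: (c r); [exact: (small_le (leq0n r) (@small_tV r))|exact: small0].
apply: smallBX => //.
  rewrite geomE -[iter _ _ _](subKr g).
  apply: smallB => //. exact: (small_le (leq0n q) (@gs q)).
by rewrite geomE; exact: gs.
Qed.

(** Parity is even at n = qk, so [iterate_even] turns F_n into a multiple of B_n + 1; the other
    terms are tails of the two series. *)
Let E_approx q : E = (t 0 * (S xpredT - inv_trace_sum B xpredT (q * k)))%:A +
  (S (parity Y) - inv_trace_sum B (parity Y) (q * k)) *: D +
  (t 0 / t (q * k)) *: (B (q * k) + 1).
Proof.
have par q' r : parity Y (q' * k + r) = parity Y r by exact: (parity_mulk Yk evenk).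
have Fq : B 0 + 1 + (t 0 * inv_trace_sum B xpredT (q * k))%:A +
    inv_trace_sum B (parity Y) (q * k) *: D = (t 0 / t (q * k)) *: (B (q * k) + 1).
  apply: (iterate_even L2 BS CS dB dC tr0 tu).
  by rewrite -[(q * k)%N]addn0 par /parity big_ord0.
rewrite -Fq /E.
move: (S _) (S _) (inv_trace_sum _ _ _) (inv_trace_sum _ _ _) (B 0 + 1) (t 0) D.
move=> s1 s2 s1' s2' b t0 d; rewrite mulrBr !scalerBl.
by rewrite [RHS](AC ((2*2)*3) ((5*(1*(2*6)))*(3*(4*7))))%AC /= !addNr !addr0.
Qed.

Let entry (A : 'M[L]_2) r := A r 0 + A r 1 * y.

Let entryD A A' r : entry (A + A') r = entry A r + entry A' r.
Proof. by rewrite /entry !mxE mulrDl addrACA. Qed.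

Let entryZ a A r : entry (a *: A) r = a * entry A r.
Proof. by rewrite /entry !mxE mulrDr mulrA. Qed.

Let small_entry i r : small 0 (entry (B i) r).
Proof. by rewrite /entry /B wuE; exact: small_word_mx_CF. Qed.

(** Apply [E_approx] to the vector (1, 1/CF(u)): the tails tend to 0, and so does the last term, as
    B_n keeps the vector bounded while 1/t_n tends to 0. *)
Lemma kernel_CF r : entry E r = 0.
Proof.
pose w := entry 1 r.
(* These orders may be negative but do not depend on q; the shift in [order_ge_eq0] absorbs them. *)
have [K1 tK] := order_ge_ex (t 0); have [K2 DK] := order_ge_ex (entry D r).
have w0 : small 0 w by exact: (@small_word_mx_CF _ F2 _ u 0 r).
apply: (@order_ge_eq0 _ _ _ (- (K1 + K2)%:Z)) => q; set n := (q * k)%N.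
have -> : entry E r = t 0 * ((S xpredT - inv_trace_sum B xpredT n) * w) +
    entry D r * (S (parity Y) - inv_trace_sum B (parity Y) n) +
    t 0 * ((t n)^-1 * (entry (B n) r + w)).
  rewrite (E_approx q) -/n (entryD (_ + _)) (entryD _%:A) !entryZ (entryD (B n)) -/w.
  by rewrite [entry D r * _]mulrC !mulrA.
have t0K f : small q f -> order_ge (q%:Z - (K1 + K2)%:Z) (t 0 * f).
  move=> /small_order_ge fq m /(order_geM tK fq); lia.
apply: order_geD; first apply: order_geD.
- by apply: t0K; apply: smallMr => //; exact: small_S.
- have /small_order_ge sq : small q (S (parity Y) - inv_trace_sum B (parity Y) n).
    by apply: small_S => q' i; exact: (parity_mulk Yk evenk).
  by move=> m /(order_geM DK sq); lia.
- apply: t0K; apply: smallMr; last by apply: smallD.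
  by apply: (@small_le _ _ q n); [rewrite leq_pmulr|exact: small_tV].
Qed.

(** This excludes E = 0. Scalar matrices and [D] are traceless in characteristic 2, so only B_0
    contributes. *)
Lemma trE : \tr E = t 0.
Proof.
rewrite !mxtraceD !mxtraceZ mxtrace1 (_ : \tr (B 0) = t 0)//.
have -> : 2%:R = 0 :> L by exact: pcharf0 L2.
have -> : \tr D = 0 by rewrite mxtraceD tr0 addrr_pchar2.
by rewrite !mulr0 !addr0.
Qed.

(** The second column of [E] is CF(u) times the first; if the first vanished, the trace t_0 would be
    0. *)
Lemma kernel_pivot : exists r, E r 0 != 0 /\ CF 'F_2 u * E r 0 = E r 1.
Proof.
have xE r : CF 'F_2 u * E r 0 = E r 1.
  have := kernel_CF r; rewrite /entry => /eqP.
  rewrite addr_eq0 oppr_pchar2// => /eqP ->.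
  by rewrite mulrCA divrr ?mulr1// CF_unit.
case: (eqVneq (E 0 0) 0) => [E00|]; last by exists 0.
case: (eqVneq (E 1 0) 0) => [E10|]; last by exists 1.
have t00 : t 0 != 0 by apply: contraTneq (tu 0) => ->; rewrite unitr0.
case/eqP: t00; rewrite -trE mxtrace2 E00 add0r -(xE 1) E10 mulr0 //.
Qed.

Let P (f : L) := adjoined (@lfrac 'F_2 h.+1) g%:F f%:F.

Let PD f f' : P f -> P f' -> P (f + f').
Proof. by move=> Pf Pf'; rewrite /P rmorphD; exact: adjoinedD. Qed.
Let PM f f' : P f -> P f' -> P (f * f').
Proof. by move=> Pf Pf'; rewrite /P rmorphM; exact: adjoinedM. Qed.
Let P_rational f : rational f -> P f.
Proof. by move=> [c fc]; rewrite /P fc; exact: adjoined_cst. Qed.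

Let rational_t i : rational (t i).
Proof. by rewrite /t mxtrace2; apply: rationalD; exact: rational_word_mx. Qed.

Let PS c : P (S c).
Proof.
rewrite /S; elim/big_ind: _ => [||i _].
- exact/P_rational/(rational_nat _ _ 0).
- exact: PD.
- apply: PM; last first.
    elim: (2 ^ i)%N => [|d IH]; first exact/P_rational/(rational_nat _ _ 1).
    by rewrite exprS; apply: PM => //; exact: adjoined_gen.
  rewrite -mulr_natr; apply: PM; apply: P_rational; last exact: rational_nat.
  exact: rationalV.
Qed.

Let PE r c : P (E r c).
Proof.
rewrite /E /D /C /B !mxE; do !apply: PD; do ?apply: PM;
  do ?exact/P_rational/rational_word_mx; do ?exact/P_rational/rational_nat; do ?exact: PS.
- exact/P_rational/rational_t.
- by apply: PD; exact/P_rational/rational_word_mx.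
Qed.

Lemma CF_algebraic_of_fixpoint : algebraic_of_degree_le (2 ^ k) (CF 'F_2 u).
Proof.
have [c kc] : rational kappa by apply: rationalM => //; exact: rationalV.
have [r [Er0 xE]] := kernel_pivot.
have k2 : (1 < 2 ^ k)%N by rewrite -{1}(expn0 2) ltn_exp2l.
(* The fixed point equation of g over F_2(A); its degree is the source of the bound, and its
   constant term -1 makes it nonzero. *)
pose f : {poly K} := 'X - 1 - c *: 'X^(2 ^ k).
apply: (@adjoined_ratio_algebraic _ _ _ _ f g%:F (E r 0)%:F (E r 1)%:F).
- apply: contraTneq (oner_neq0 K) => f0; have /polyP/(_ 0%N) := f0.
  rewrite coef0 !coefB coefX coefC coefZ coefXn (ltn_eqF (ltnW k2)) /= mulr0 subr0 sub0r.
  by move/eqP; rewrite oppr_eq0 => ->.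
- rewrite /f; apply: leq_trans (size_polyD _ _) _; rewrite geq_max size_polyN.
  apply/andP; split.
    by rewrite size_XsubC; apply: ltnW; rewrite ltnS.
  by apply: leq_trans (size_scale_leq _ _) _; rewrite size_polyXn.
- rewrite /f rmorphB rmorphB /= map_polyZ map_polyX map_polyXn rmorph1.
  have [_ /(congr1 (@FracField.tofrac L))] := fixpointE small_kappa gs.
  rewrite rmorphD rmorph1 rmorphM rmorphXn /= kc => gE.
  by rewrite /root !hornerE /= -addrA -opprD subr_eq0 -gE.
- exact: PE.
- exact: PE.
- by rewrite tofrac_eq0.
- by rewrite -rmorphM /= xE.
Qed.

End Limit.

Lemma CF_algebraic : algebraic_of_degree_le (2 ^ k) (CF 'F_2 u).
Proof.
have [g gs] := ex_fixpoint (2 ^ k) small_kappa; exact: CF_algebraic_of_fixpoint gs.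
Qed.

End Main.


(** * Traces of the generated words, and the conclusion *)

Section Words.
Variables (h : nat) (u0 v0 : seq 'I_h.+1) (Y : nat -> bool).
Local Notation U i := (words u0 v0 Y i).1.
Local Notation V i := (words u0 v0 Y i).2.

Lemma words_recl i : U i.+1 = U i ++ if Y i then V i else U i.
Proof. by rewrite /=; case: (words _ _ _ i) => u v; case: (Y i). Qed.

Lemma words_recr i : V i.+1 = V i ++ if Y i then U i else V i.
Proof. by rewrite /=; case: (words _ _ _ i) => u v; case: (Y i). Qed.

(* Once a 1 has been read, the traces are tr(UV) = tr(VU). *)
Lemma words_trace_eq (R : idomainType) i j : 2%N \in [pchar R] -> Y j -> (j < i)%N ->
  \tr (word_mx R (V i)) = \tr (word_mx R (U i)).
Proof.
move=> R2 Yj; elim: i => // i IH.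
rewrite ltnS leq_eqVlt words_recl words_recr !word_mx_cat.
case/predU1P => [<-|/IH tr_eq]; first by rewrite Yj mxtrace_mulC.
have := mxtrace_step (laurent_pchar2 R2 _) (Y i) tr_eq.
by rewrite /step; case: (Y i).
Qed.

End Words.

Theorem theorem1p2 (h : nat) (u0 v0 : seq 'I_h.+1) (Upsilon : nat -> bool)
    (k : nat) (u0_nonempty : u0 <> [::]) (v0_nonempty : v0 <> [::])
    (k_ge1 : (1 <= k)%N)
    (Upsilon_periodic : forall i : nat, Upsilon (i + k)%N = Upsilon i)
    (Upsilon_even : ~~ odd (\sum_(i < k) Upsilon i)%N) :
  algebraic_of_degree_le (2 ^ k)%N
    (CF 'F_2 (Gword u0 v0 Upsilon)).
Proof.
have [u00 v00] : u0 != [::] /\ v0 != [::] by split; apply/eqP.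
(* Shifting by one period keeps the recursion and the limit word, and puts every 1 of the first
   period before the start. *)
pose U i := (words u0 v0 Upsilon (i + k)).1; pose V i := (words u0 v0 Upsilon (i + k)).2.
have US i : U i.+1 = U i ++ if Upsilon i then V i else U i.
  by rewrite /U addSn words_recl Upsilon_periodic.
have VS i : V i.+1 = V i ++ if Upsilon i then U i else V i.
  by rewrite /V addSn words_recr Upsilon_periodic.
have [U0 V0] : U 0 != [::] /\ V 0 != [::].
  have [Us Vs] := words_size Upsilon k u00 v00.
  by rewrite /U /V add0n -!size_eq0 -!lt0n (leq_ltn_trans _ Us) ?(leq_ltn_trans _ Vs).
have UE i : U i = mkseq (Gword u0 v0 Upsilon) (size (U i)) by exact: Gword_prefix.
have [/existsP[j Yj]|/existsPn noY] := boolP [exists j : 'I_k, Upsilon j].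
  apply: (CF_algebraic k_ge1 Upsilon_periodic Upsilon_even US VS U0 V0 UE).
  exact: (words_trace_eq u0 v0 (pchar_Fp (isT : prime 2)) Yj (ltn_ord j)).
have Y0 i : Upsilon i = false.
  have modk q r : Upsilon (q * k + r)%N = Upsilon r.
    by elim: q => // q IH; rewrite mulSn -addnA addnC Upsilon_periodic.
  rewrite (divn_eq i k) modk; apply/negbTE.
  exact: (noY (Ordinal (ltn_pmod i k_ge1))).
(* With [Upsilon] identically 0, the pair (U, U) obeys the recursion and has equal traces. *)
by apply: (CF_algebraic k_ge1 Upsilon_periodic Upsilon_even _ _ U0 U0 UE) => // i;
  rewrite US Y0.
Qed.
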